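(* Let $p(x)$ be a real polynomial of even degree $n$, and let $PP=\frac{p''p}{(p')^2}$. Then $$\sharp_r\big[(n-1)(p'(x))^2-n\,p(x)p''(x)\big]+\sharp_r\, p(x)=0$$ if and only if $$PP\in \Gamma_{11}\cup\Gamma_{121}\cup\Gamma_{2121}\cup\Gamma_{2321}.$$
   Context: $\sharp_r q$ denotes the number of real zeros of a polynomial $q$. Root locus terminology. For a real polynomial $p$ of even degree $n$, put $PP(s)=\frac{p''(s)p(s)}{p'(s)^2}$ and consider the equation $K\cdot PP(s)=\pm1$, where the gain is $K=K(s)=\left|\frac{p'(s)^2}{p''(s)p(s)}\right|$ ($K=0$ at poles of $PP$, $K=+\infty$ at zeros of $PP$). Put $K_0=\frac{n}{n-1}$. The points where the right-hand side is $1$ (argument of $PP$ equal to $2q\pi$, $q\in\mathbb Z$, i.e. $PP$ is positive real) form curves called root loci of $2q\pi$ degree; those where it is $-1$ (argument $2q\pi+\pi$, i.e. $PP$ is negative real) form curves called root loci of $2q\pi+\pi$ degree. A (single) root locus is an entire branch going from a starting point (a pole, or infinity) to an ending point (a zero, or infinity); it is said to extend in the direction from its pole to its zero. A breakaway point is a point, neither a zero nor a pole, where at least two root loci intersect. A real breakaway point is standard if on the real axis two distinct root loci lie on its two sides, either both extending toward it or both extending away from it; it is non-standard if only one root locus lies on the real axis on its two sides (passing through it). A standard real breakaway point is a maximum (respectively minimum) real breakaway point if the gain $K$, on the real axis, attains a local maximum (respectively local minimum) there. A real interval is a root locus of $2q\pi$ degree if its points have argument $2q\pi$, i.e. $PP>0$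 on it. Classes. ''$PP\in X$'' means that $p$ has the property defining $X$. $\Gamma$: $p$ has no real zeros, and $p'$ has exactly one real zero, denoted $p_0$, which is simple. $\Gamma_1\subseteq\Gamma$: $p''$ has no real zeros. $\Gamma_2\subseteq\Gamma$: $p''$ has a real zero. $\Gamma_{11}\subseteq\Gamma_1$: the root loci of $PP$ have no standard real breakaway points. $\Gamma_{12}\subseteq\Gamma_1$: the root loci of $PP$ have at least one standard real breakaway point. $\Gamma_{121}\subseteq\Gamma_{12}$: the gains at all maximum real breakaway points are less than $K_0$. $\Gamma_{21}\subseteq\Gamma_2$: $p''$ has real zeros to the right of $p_0$ and none to the left. $\Gamma_{23}\subseteq\Gamma_2$: $p''$ has real zeros both to the right and to the left of $p_0$. Intervals. When they exist, let $z_m$ be the largest real zero of $p''$ to the right of $p_0$, and $z_s$ the smallest real zero of $p''$ to the left of $p_0$. $(z_m,+\infty)$ is the right infinite interval. If $(-\infty,z_s)$ is a root locus of $2q\pi$ degree, it is called the left infinite interval of $2q\pi$ degree. For two adjacent real zeros $z_1<z_2$ of $p''$, both to the right or both to the left of $p_0$, if $(z_1,z_2)$ is a root locus of $2q\pi$ degree it is called a finite interval of $2q\pi$ degree. $\Gamma_{212}\subseteq\Gamma_{21}$: $p''$ has an odd number of real zeros, counted with multiplicity, to the right of $p_0$. $\Gamma_{2121}\subseteq\Gamma_{212}$: in $(z_m,+\infty)$ there is no standard real breakaway point, or all minimum real breakaway points there have gains greater than $K_0$; and in all finite intervals of $2q\pi$ degree to the right of $p_0$ (if any exist) all minimum real breakaway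 points have gains greater than $K_0$. $\Gamma_{232}\subseteq\Gamma_{23}$: $p''$ has an odd number of real zeros, counted with multiplicity, to the right of $p_0$. $\Gamma_{2321}\subseteq\Gamma_{232}$: in $(z_m,+\infty)$ there is no standard real breakaway point, or all minimum real breakaway points there have gains greater than $K_0$; in all finite intervals of $2q\pi$ degree to the right of $p_0$ and in all finite intervals of $2q\pi$ degree to the left of $p_0$ (if any exist) all minimum real breakaway points have gains greater than $K_0$; and, if the left infinite interval $(-\infty,z_s)$ of $2q\pi$ degree exists, in it there is no standard real breakaway point, or all minimum real breakaway points there have gains greater than $K_0$. *)

(* Defs.v *)
From mathcomp Require Import all_boot all_order all_algebra.
From mathcomp Require Import all_classical all_reals all_analysis.
From mathcomp Require Import complex polyrcf.
Import Order.TTheory GRing.Theory Num.Theory numFieldNormedType.Exports.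

Set Implicit Arguments.
Unset Strict Implicit.
Unset Printing Implicit Defensive.

Local Open Scope classical_set_scope.
Local Open Scope ring_scope.
Local Open Scope complex_scope.

Section RealZeros.
Variable R : realType.
Implicit Types (p q : {poly R}) (a : pred R).

(* With multiplicity; meaningful for q != 0 only, as [rootsR 0 = [::]]. *)
Definition nb_real_zeros_in q a : nat := (\sum_(x <- rootsR q | a x) mup x q)%N.

(* The zero polynomial has infinitely many real zeros. *)
Definition sharp_r q : \bar R :=
  if q == 0 then +oo%E else (nb_real_zeros_in q predT)%:R%:E.

End RealZeros.

Section RootLoci.
Variable R : realType.
Implicit Types (p : {poly R}) (s : R[i]) (x k : R) (I : set R).

(* PP = PPnum / PPden in lowest terms: at a multiple zero of p the singularity
   of p'' p / p'^2 is removable, and such a point is neither a zero nor a pole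
   of PP. *)
Definition PPgcd p : {poly R} := gcdp (p^`(2) * p) (p^`() ^+ 2).
Definition PPnum p : {poly R} := (p^`(2) * p) %/ PPgcd p.
Definition PPden p : {poly R} := p^`() ^+ 2 %/ PPgcd p.

Definition ceval p s : R[i] := (map_poly (real_complex R) p).[s].

(* Equal to 0 at the poles, by the convention 0^-1 = 0. *)
Definition PP p s : R[i] := ceval (PPnum p) s / ceval (PPden p) s.

Definition is_pole p s : Prop := ceval (PPden p) s = 0.
Definition is_zero p s : Prop := ceval (PPnum p) s = 0.

Definition gain p s : \bar R :=
  if ceval (PPden p) s == 0 then 0%E
  else if ceval (PPnum p) s == 0 then +oo%E
  else (complex.Re `|(PP p s)^-1|)%:E.

Definition K0 p : R := (size p).-1%:R / ((size p).-1%:R - 1).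

Definition to_infinity (F : set_system R) (g : R -> R[i]^o) : Prop :=
  complex.Re `|g k| @[k --> F] --> +oo%R.

(* Filter of the gains tending to the upper end b of a gain interval. *)
Definition gain_upto (b : \bar R) : set_system R :=
  if b is r%:E then r^'- else pinfty_nbhs R.

(* A single root locus, parametrized by the gain k, so that a locus extends, in
   the direction of increasing k, from a pole (k = 0) or infinity to a zero
   (k = +oo) or infinity. The sign is false for the loci of degree 2q pi
   (k PP = 1) and true for those of degree 2q pi + pi (k PP = - 1). The values
   of the curve outside the open gain interval are irrelevant. *)
Record root_locus p := RootLocus {
  rl_sign : bool;
  rl_from : R;
  rl_to : \bar R;
  rl_curve : R -> R[i]^o;
  rl_from_ge0 : 0 <= rl_from;
  rl_from_lt_to : (rl_from%:E < rl_to)%E;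
  rl_equation : forall k, (rl_from%:E < k%:E < rl_to)%E ->
    k%:C * PP p (rl_curve k) = (-1) ^+ rl_sign;
  rl_continuous : forall k, (rl_from%:E < k%:E < rl_to)%E ->
    {for k, continuous rl_curve};
  rl_starts :
    (exists2 s : R[i]^o, is_pole p s & rl_curve k @[k --> rl_from^'+] --> s)
    \/ to_infinity rl_from^'+ rl_curve;
  rl_ends :
    (exists2 s : R[i]^o, is_zero p s &
       rl_curve k @[k --> gain_upto rl_to] --> s)
    \/ to_infinity (gain_upto rl_to) rl_curve
}.

Definition passes_at p (L : root_locus p) k s : Prop :=
  ((rl_from L)%:E < k%:E < rl_to L)%E /\ rl_curve L k = s.

(* Two loci that merely coincide along an arc and separate elsewhere do not
   intersect at the inner points of that arc. *)
Definition intersect_at p (L1 L2 : root_locus p) s : Prop :=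
  exists k, [/\ passes_at L1 k s, passes_at L2 k s
    & ~ \forall k' \near k, rl_curve L1 k' = rl_curve L2 k'].

Definition breakaway p s : Prop :=
  [/\ ~ is_zero p s, ~ is_pole p s
    & exists L1 L2 : root_locus p, intersect_at L1 L2 s].

(* right = true is the right side of x, right = false the left side. *)
Definition on_side (right : bool) x s : Prop :=
  exists y, s = y%:C /\ (if right then x < y else y < x).

(* On the given real side of x, L lies on the real axis and, as the gain grows,
   extends toward x, resp. (extends_away) away from x. *)
Definition extends_toward p (right : bool) (L : root_locus p) x : Prop :=
  exists k, passes_at L k x%:C /\
    \forall k' \near k^'-, on_side right x (rl_curve L k').

Definition extends_away p (right : bool) (L : root_locus p) x : Prop :=
  exists k, passes_at L k x%:C /\
    \forall k' \near k^'+, on_side right x (rl_curve L k').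

Definition standard_real_breakaway p x : Prop :=
  breakaway p x%:C /\
  exists L1 L2 : root_locus p, intersect_at L1 L2 x%:C /\
    ((extends_toward false L1 x /\ extends_toward true L2 x) \/
     (extends_away false L1 x /\ extends_away true L2 x)).

Definition max_real_breakaway p x : Prop :=
  standard_real_breakaway p x /\
  \forall y \near x, (gain p y%:C <= gain p x%:C)%E.

Definition min_real_breakaway p x : Prop :=
  standard_real_breakaway p x /\
  \forall y \near x, (gain p x%:C <= gain p y%:C)%E.

Definition is_2qpi_interval p I : Prop := forall x, I x -> 0 < PP p x%:C.

Definition no_standard_in p I : Prop :=
  forall x, I x -> ~ standard_real_breakaway p x.

Definition min_gains_gt_K0 p I : Prop :=
  forall x, I x -> min_real_breakaway p x -> ((K0 p)%:E < gain p x%:C)%E.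

End RootLoci.

Section Classes.
Variable R : realType.
Implicit Types (p : {poly R}) (x z : R).

(* The real zero of p', when there is exactly one. *)
Definition p0 p : R := xget 0 [set x | root p^`() x].

Definition Gamma p : Prop :=
  [/\ forall x, ~~ root p x,
      exists! x, root p^`() x
    & mup (p0 p) p^`() = 1%N].

Definition Gamma1 p : Prop := Gamma p /\ forall x, ~~ root p^`(2) x.
Definition Gamma2 p : Prop := Gamma p /\ exists x, root p^`(2) x.

Definition Gamma11 p : Prop :=
  Gamma1 p /\ forall x, ~ standard_real_breakaway p x.
Definition Gamma12 p : Prop :=
  Gamma1 p /\ exists x, standard_real_breakaway p x.
Definition Gamma121 p : Prop :=
  Gamma12 p /\
  forall x, max_real_breakaway p x -> (gain p x%:C < (K0 p)%:E)%E.

Definition right_zero p z : Prop := root p^`(2) z /\ p0 p < z.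
Definition left_zero p z : Prop := root p^`(2) z /\ z < p0 p.

Definition Gamma21 p : Prop :=
  [/\ Gamma2 p, exists z, right_zero p z & forall z, ~ left_zero p z].
Definition Gamma23 p : Prop :=
  [/\ Gamma2 p, exists z, right_zero p z & exists z, left_zero p z].

Definition is_zm p z : Prop :=
  right_zero p z /\ forall y, right_zero p y -> y <= z.
Definition is_zs p z : Prop :=
  left_zero p z /\ forall y, left_zero p y -> z <= y.

Definition adjacent_zeros p (z1 z2 : R) : Prop :=
  [/\ root p^`(2) z1, root p^`(2) z2, z1 < z2
    & forall y, z1 < y < z2 -> ~~ root p^`(2) y].

Definition right_infinite_cond p : Prop :=
  forall z, is_zm p z ->
    (no_standard_in p `]z, +oo[) \/ min_gains_gt_K0 p `]z, +oo[.

Definition left_infinite_cond p : Prop :=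
  forall z, is_zs p z -> is_2qpi_interval p `]-oo, z[ ->
    (no_standard_in p `]-oo, z[) \/ min_gains_gt_K0 p `]-oo, z[.

Definition right_finite_cond p : Prop :=
  forall z1 z2, adjacent_zeros p z1 z2 -> p0 p < z1 ->
    is_2qpi_interval p `]z1, z2[ -> min_gains_gt_K0 p `]z1, z2[.

Definition left_finite_cond p : Prop :=
  forall z1 z2, adjacent_zeros p z1 z2 -> z2 < p0 p ->
    is_2qpi_interval p `]z1, z2[ -> min_gains_gt_K0 p `]z1, z2[.

Definition odd_right_zeros p : Prop :=
  odd (nb_real_zeros_in p^`(2) (fun x => p0 p < x)).

Definition Gamma212 p : Prop := Gamma21 p /\ odd_right_zeros p.
Definition Gamma2121 p : Prop :=
  [/\ Gamma212 p, right_infinite_cond p & right_finite_cond p].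

Definition Gamma232 p : Prop := Gamma23 p /\ odd_right_zeros p.
Definition Gamma2321 p : Prop :=
  [/\ Gamma232 p, right_infinite_cond p, right_finite_cond p,
      left_finite_cond p & left_infinite_cond p].

End Classes.

(* Main.v *)
Require Import Defs.
From mathcomp Require Import all_boot all_order all_algebra.
From mathcomp Require Import all_classical all_reals all_analysis.
From mathcomp Require Import complex polyrcf polyorder zify ring lra.
Import Order.TTheory GRing.Theory Num.Theory numFieldNormedType.Exports.

(* Write W = (n-1) p'^2 - n p p''.  The left-hand side says that neither W nor p
   has a real zero.

   The classes Gamma2121 and Gamma2321 are empty: p'' has the sign of the leading
   coefficient of p both at p0 and at +oo, so it has an even number of zeros to
   the right of p0.

   If W and p have no real zeros, then W < 0 at the rightmost zero of p', hence
   everywhere; thus p p'' > 0, which gives Gamma1, and the gain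
   p'^2 / (p p'') is less than K0 = n/(n-1) on the whole real line.

   Conversely, in Gamma1 the gain is defined and nonnegative on the real line and
   tends to K0 at both infinities.  If W has a real zero, the gain takes the value
   K0 there, so it attains a global maximum, at least K0, at some point xm.
   To contradict Gamma11 and Gamma121 one has to see that xm is a standard
   breakaway point, that is, to extend the two real branches of the gain at xm to
   entire root loci.  The substitutions s = c + 1/t and x = k/(1+k), for a c with
   PP(c) = -1, turn k PP(s) = 1 into a pencil a - x e, 0 <= x <= 1, with a monic of
   degree larger than e, so that no root escapes to infinity; a root of a member of
   such a pencil can be continued along the whole of [0, 1]. *)

Set Implicit Arguments.
Unset Strict Implicit.
Unset Printing Implicit Defensive.

Local Open Scope classical_set_scope.
Local Open Scope ring_scope.
Local Open Scope complex_scope.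

(** * Continuation of roots along a pencil *)

(** For monic [g], [|g(s)|] is the product of the distances from [s] to the [d + 1] roots, so the
    nearest root satisfies the bound. *)
Lemma near_root (C : numClosedFieldType) (g : {poly C}) d s :
  g \is monic -> size g = d.+2 ->
  exists r, root g r /\ `|s - r| ^+ d.+1 <= `|g.[s]|.
Proof.
move=> /monicP g_monic; have [rs Drs] := closed_field_poly_normal g.
rewrite {}Drs g_monic scale1r size_prod_XsubC => -[szrs].
have -> : `|(\prod_(z <- rs) ('X - z%:P)).[s]| = \prod_(z <- rs) `|s - z|.
  by rewrite horner_prod normr_prod; apply: eq_bigr => z _; rewrite hornerXsubC.
rewrite -szrs.
have: (0 < size rs)%N by rewrite szrs.
move=> {g g_monic}; elim: rs {d szrs} => // x [|y rs] IHrs _.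
  by exists x; rewrite !big_seq1 root_XsubC expr1.
have [//|r [r_root r_le]] := IHrs.
have rs_root : root (\prod_(z <- [:: x, y & rs]) ('X - z%:P)) r.
  by rewrite big_cons rootM r_root orbT.
have real_norm (z : C) : `|z| \is Num.real by rewrite realE normr_ge0.
have [le_rx|lt_xr] := real_leP (real_norm (s - r)) (real_norm (s - x)).
  exists r; split=> //; rewrite exprS big_cons ler_pM ?exprn_ge0 //.
exists x; split; first by rewrite big_cons rootM root_XsubC eqxx.
rewrite exprS big_cons ler_wpM2l //; apply: le_trans r_le.
by rewrite lerXn2r ?nnegrE // ltW.
Qed.

(* Each center accounts for one maximal excursion: jump from the first to the
   last index close to it, then discard it. *)
Lemma small_steps_near_points (C : numDomainType) (eta : C) (c : seq C)
    (s : nat -> C) i j :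
  0 <= eta -> (i <= j)%N ->
  (forall k, (i <= k < j)%N -> `|s k - s k.+1| <= eta) ->
  (forall k, (i <= k <= j)%N -> exists2 r, r \in c & `|s k - r| <= eta) ->
  `|s i - s j| <= eta *+ (3 * size c).
Proof.
move=> eta_ge0; have [m] := ubnP (size c).
elim: m c i => // m IHm c i; rewrite ltnS => c_le ij step near_c.
have [r rc sir] := near_c i ltac:(by rewrite leqnn).
pose P k := (i <= k <= j)%N && (`|s k - r| <= eta).
have Pi : exists k, P k by exists i; rewrite /P leqnn ij.
have Pj k : P k -> (k <= j)%N by case/andP=> /andP[].
case: (ex_maxnP Pi Pj) => k /andP[/andP[ik kj] skr] kmax.
have sik : `|s i - s k| <= eta *+ 2.
  by rewrite (le_trans (ler_distD r _ _)) // mulr2n lerD // distrC.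
have c_gt0 : (0 < size c)%N by case: (c) rc.
have [jk|k_lt_j] := leqP j k.
  have -> : j = k by apply/eqP; rewrite eqn_leq jk kj.
  by rewrite (le_trans sik) // ler_wpMn2l //; lia.
have sz_rem : size (rem r c) = (size c).-1 by rewrite size_rem.
have tail : `|s k.+1 - s j| <= eta *+ (3 * size (rem r c)).
  apply: IHm => //.
  - by rewrite sz_rem; lia.
  - by move=> l /andP[kl lj]; apply: step; lia.
  move=> l /andP[kl lj]; have il : (i <= l)%N by apply: leq_trans ik (ltnW kl).
  have [r' r'c slr'] := near_c l ltac:(by rewrite il).
  (* A later index close to [r] would contradict the maximality of [k]. *)
  exists r' => //; have r'r : r' != r.
    apply: contraTneq kl => r'r; rewrite -leqNgt; apply: kmax.
    by rewrite /P -r'r slr' lj andbT; lia.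
  move: r'c; rewrite (perm_mem (perm_to_rem rc)) inE (negPf r'r) //.
(* Two [eta] for the excursion around [r], one for the step leaving it, and the rest by induction
   without [r]. *)
have -> : (3 * size c = 2 + (1 + 3 * size (rem r c)))%N by rewrite sz_rem; lia.
rewrite mulrnDr (mulrnDr _ 1) mulr1n.
apply: (le_trans (ler_distD (s k) _ _)); rewrite lerD //.
apply: (le_trans (ler_distD (s k.+1) _ _)); rewrite lerD //.
by apply: step; lia.
Qed.

(** Cauchy's bound, uniform in [x]: at a root with [|s| > 1], [s^n] equals the terms of lower
    degree, whose norm is at most [S |s|^(n-1)]. *)
Lemma monic_family_root_bound (C : numFieldType) (a e : {poly C}) :
  a \is monic -> (size e < size a)%N ->
  exists M : C, forall x s, `|x| <= 1 -> root (a - x *: e) s -> `|s| <= M.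
Proof.
move=> a_monic; case sza: (size a) => [//|n]; rewrite ltnS => e_le.
pose S := \sum_(i < n) (`|a`_i| + `|e`_i|).
have S_ge0 : 0 <= S by apply: sumr_ge0 => i _; rewrite addr_ge0.
exists (1 + S) => x s x_le1 /rootP.
have real_norm (z : C) : `|z| \is Num.real by rewrite realE normr_ge0.
have [s_le1 _|s_gt1] := real_leP (real_norm s) (rpred1 _).
  by rewrite (le_trans s_le1) // lerDl.
rewrite hornerD hornerN hornerZ => /eqP.
rewrite (horner_coef_wide _ (leqnn (size a))).
rewrite sza big_ord_recr /=.
have -> : a`_n = 1 by have /monicP := a_monic; rewrite lead_coefE sza.
rewrite mul1r (horner_coef_wide s e_le).
rewrite mulr_sumr addrAC -sumrB addrC addr_eq0 => /eqP/(congr1 Num.norm).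
rewrite normrN normrX => sn.
have s_gt0 : 0 < `|s| by rewrite (lt_trans _ s_gt1).
case: (posnP n) => [n0|n_gt0].
  move/eqP: sn; rewrite big1 => [|k _].
    by rewrite n0 expr0 normr0 oner_eq0.
  by exfalso; case: k => k; rewrite n0.
have : `|s| ^+ n <= S * `|s| ^+ n.-1.
  rewrite sn (le_trans (ler_norm_sum _ _ _)) // mulr_suml ler_sum // => i _.
  rewrite (mulrA x) -mulrBl normrM normrX ler_pM ?exprn_ge0 //.
    rewrite (le_trans (ler_normB _ _)) // lerD2l normrM ler_piMl //.
  rewrite ler_weXn2l // ?ltW //; have := ltn_ord i; lia.
rewrite -{1}(prednK n_gt0) exprS ler_pM2r ?exprn_gt0 // => /le_trans; apply.
by rewrite lerDr.
Qed.

(** The fibres of [f] are finitely many, and an ultrafilter contains one of them: otherwise it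
    contains all their complements, whose intersection is empty. *)
Lemma ultra_finite_range (T : Type) (I : eqType) (U : set_system T)
    (f : T -> I) (s : seq I) :
  UltraFilter U -> (forall x, f x \in s) ->
  exists i, U [set x | f x = i].
Proof.
move=> UU; suff H (V : set T) : U V -> (forall x, V x -> f x \in s) ->
    exists i, U [set x | f x = i].
  by move=> fs; apply: (H setT) => //; exact: filterT.
elim: s V => [|i s IHs] V UV fs.
  have /filter_ex [x Vx] := UV; by have := fs x Vx.
have [Ui|UiC] := in_ultra_setVsetC [set x | f x = i] UU; first by exists i.
apply: (IHs (V `&` ~` [set x | f x = i])); first exact: filterI.
move=> x [Vx /= fxi]; have := fs x Vx; rewrite inE => /orP[/eqP//|//].
Qed.

Section LiftRoots.
Variable R : realType.
Implicit Types (a e : {poly R[i]}) (x y : R).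

Lemma gt0_complex_real (z : R[i]) : 0 < z -> exists2 x : R, 0 < x & z = x%:C.
Proof. by case: z => x y; rewrite ltcE /= => /andP[/eqP -> x_gt0]; exists x. Qed.

Lemma normC_real x : `|x%:C| = `|x|%:C.
Proof. by rewrite normc_def /= expr0n addr0 sqrtr_sqr. Qed.

(* Greedy approximate lifts on the meshes j/(N+1) never leave the vicinity of
   the finitely many roots at a given parameter, hence are equicontinuous up to
   the mesh; a lift is their limit along an ultrafilter on N. *)
Lemma lift_roots a e t0 :
  a \is monic -> (size e < size a)%N -> root a t0 ->
  exists t : R -> R[i],
    [/\ t 0 = t0,
        forall x, 0 <= x <= 1 -> root (a - x%:C *: e) (t x)
      & forall eps : R, 0 < eps -> exists2 delta : R, 0 < delta &
          forall x y, 0 <= x <= 1 -> 0 <= y <= 1 -> `|x - y| <= delta ->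
            `|t x - t y| <= eps%:C].
Proof.
move=> a_monic e_lt a_t0; pose g x := a - x%:C *: e.
have a_neq0 := monic_neq0 a_monic.
have sz_xe x : (size (- (x%:C *: e)) < size a)%N.
  by rewrite size_polyN (leq_ltn_trans (size_scale_leq _ _)).
have [d sza] : exists d, size a = d.+2.
  exists (size a).-2; have := root_size_gt1 a_neq0 a_t0; lia.
have g_monic x : g x \is monic.
  by rewrite monicE lead_coefDl // -monicE.
have szg x : size (g x) = d.+2 by rewrite size_polyDl.
have /choice [nr nrP] : forall xs : R * R[i], exists r,
    root (g xs.1) r /\ `|xs.2 - r| ^+ d.+1 <= `|(g xs.1).[xs.2]|.
  by move=> [x s]; apply: near_root.
have nr_root x s : root (g x) (nr (x, s)) by case: (nrP (x, s)).
have {nrP} nr_near x s : `|s - nr (x, s)| ^+ d.+1 <= `|(g x).[s]|.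
  by case: (nrP (x, s)).
have [M rootM] := monic_family_root_bound a_monic e_lt.
have [E0 eE0] := poly_disk_bound e M.
have [E1 E1E] : exists E1 : R, `|E0| = E1%:C by eexists; rewrite normc_def.
have E1_ge0 : 0 <= E1 by rewrite -lecR -E1E normr_ge0.
(* The added 1 makes the bound positive, so that [delta] below can be defined by dividing by it. *)
pose E : R := E1 + 1; have E_gt0 : 0 < E by rewrite ltr_wpDl.
have eE x s : 0 <= x <= 1 -> root (g x) s -> `|e.[s]| <= E%:C.
  move=> /andP[x0 x1] gs.
  have x1' : `|x%:C| <= 1 by rewrite normC_real ger0_norm ?lecR.
  have -> : E%:C = E1%:C + 1 by rewrite /E rmorphD rmorph1.
  rewrite -E1E ler_wpDr ?ler01 //.
  have es := eE0 _ (rootM _ _ x1' gs).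
  by rewrite (ger0_norm (le_trans (normr_ge0 _) es)).
(* A root [s] of [g x] is almost a root of [g y], since [g y] takes the value [(x - y) e(s)] at
   [s]. *)
have nr_step x y s : 0 <= x <= 1 -> root (g x) s ->
    `|s - nr (y, s)| ^+ d.+1 <= (`|x - y| * E)%:C.
  move=> x01 gs; apply: le_trans (nr_near y s) _.
  have -> : (g y).[s] = (x%:C - y%:C) * e.[s].
    rewrite /g !(hornerE, hornerZ) mulrBl.
    move/rootP: gs; rewrite /g !(hornerE, hornerZ) => /eqP.
    by rewrite subr_eq0 => /eqP ->.
  rewrite normrM rmorphM /= ler_pM //; last exact: eE gs.
  by rewrite -rmorphB normC_real.
pose z N j : R := j%:R / N.+1%:R.
pose u N := fix u j := if j is k.+1 then nr (z N j, u k) else t0.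
(* At [x] the approximate lift takes a root of [g x] chosen near its value at the last mesh point
   not after [x]. *)
pose tN N x := nr (x, u N (Num.truncn (N.+1%:R * x))).
have [U [UU ooU]] := @ultraFilterLemma nat \oo _.
(* The values lie among the finitely many roots of [g x], so they are constant along the
   ultrafilter, and their limit is again a root. *)
have lim x : exists s, U [set N | tN N x = s].
  have [rs Drs] := closed_field_poly_normal (g x).
  apply: (@ultra_finite_range _ _ U _ rs) => // N.
  have := nr_root x (u N (Num.truncn (N.+1%:R * x))).
  rewrite Drs (monicP (g_monic x)) scale1r root_prod_XsubC //.
have {lim} [t tP] := choice lim.
have u_root N k : root (g (z N k)) (u N k).
  case: k => [|k]; last exact: nr_root.
  by rewrite /g /z mul0r scale0r subr0.
exists t; split.
- have /filter_ex [N <-] := tP 0.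
  have := nr_near 0 t0; rewrite /g scale0r subr0 (rootP a_t0) normr0.
  rewrite /tN mulr0 truncn0 /= => le0.
  have : `|t0 - nr (0, t0)| ^+ d.+1 == 0 by rewrite eq_le le0 exprn_ge0.
  by rewrite expf_eq0 /= normr_eq0 subr_eq0 => /eqP.
- by move=> x _; have /filter_ex [N <-] := tP x; apply: nr_root.
(* [3 (d + 1)] counts the steps around the [d + 1] roots of [g x]; the other two pass from the mesh
   points [i] and [j] to [x] and [y]. *)
move=> eps eps_gt0; pose K := (3 * d.+1 + 2)%N.
pose eta := eps / K%:R.
have eta_gt0 : 0 < eta by rewrite divr_gt0 ?ltr0n.
(* Chosen so that, by [nr_step], a change of parameter of at most [2 * delta] moves the chosen root
   by at most [eta]. *)
pose delta := eta ^+ d.+1 / (2 * E).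
have delta_gt0 : 0 < delta by rewrite divr_gt0 ?exprn_gt0 // mulr_gt0.
have close (s r : R[i]) w :
    `|s - r| ^+ d.+1 <= (w * E)%:C -> w <= 2 * delta -> `|s - r| <= eta%:C.
  move=> sr w_le; have etaC_ge0 : 0 <= eta%:C by rewrite lecR ltW.
  rewrite -(@ler_pXn2r _ d.+1) ?nnegrE //.
  apply: le_trans sr _; rewrite -rmorphXn lecR.
  have -> : eta ^+ d.+1 = 2 * delta * E.
    by rewrite /delta; field; rewrite gt_eqF.
  by rewrite ler_pM2r.
exists delta => // x y.
wlog xy : x y / x <= y.
  move=> H x01 y01; have [|/ltW yx] := leP x y; first by move=> ?; apply: H.
  by rewrite distrC (distrC (t x)); apply: H.
move=> /andP[x0 x1] /andP[y0 y1]; rewrite ler0_norm ?subr_le0 // opprB => xy_le.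
have Usmall : U [set N | (N.+1%:R)^-1 <= delta].
  apply: ooU; have := near_infty_natSinv_lt (PosNum delta_gt0).
  by apply: filterS => N /= /ltW.
have [N /= [[Nx Ny] N_le]] := filter_ex (filterI (filterI (tP x) (tP y)) Usmall).
rewrite -Nx -Ny /tN; set i := Num.truncn _; set j := Num.truncn (_ * y).
have N1_gt0 : 0 < N.+1%:R :> R by rewrite ltr0n.
have /andP[zi_le lt_zi] : z N i <= x < z N i + N.+1%:R^-1.
  rewrite /z -[X in _ + X]mul1r -mulrDl ler_pdivrMr // ltr_pdivlMr // mulrC natr1.
  by rewrite truncn_itv // mulr_ge0 // ltW.
have /andP[zj_le lt_zj] : z N j <= y < z N j + N.+1%:R^-1.
  rewrite /z -[X in _ + X]mul1r -mulrDl ler_pdivrMr // ltr_pdivlMr // mulrC natr1.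
  by rewrite truncn_itv // mulr_ge0 // ltW.
have z_mono k l : (k <= l)%N -> z N k <= z N l.
  by move=> kl; rewrite ler_pM2r ?invr_gt0 // ler_nat.
have z_ge0 k : 0 <= z N k by rewrite divr_ge0.
have ij : (i <= j)%N by rewrite le_truncn // ler_pM2l.
have z01 k : (i <= k <= j)%N -> 0 <= z N k <= 1.
  by move=> /andP[_ kj]; rewrite z_ge0; have := z_mono _ _ kj; lra.
have [rs Drs] := closed_field_poly_normal (g x).
rewrite (monicP (g_monic x)) scale1r in Drs.
have sz_rs : size rs = d.+1.
  by have := szg x; rewrite Drs size_prod_XsubC => -[].
have u_near k : (i <= k <= j)%N -> `|u N k - nr (x, u N k)| <= eta%:C.
  move=> ikj; apply: (close _ _ _ (nr_step _ x _ (z01 k ikj) (u_root N k))).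
  case/andP: ikj => ik kj; have z1 := z_mono _ _ ik; have z2 := z_mono _ _ kj.
  move: (N.+1%:R^-1) N_le zi_le lt_zi zj_le lt_zj z1 z2 => w.
  move: (z N i) (z N k) (z N j) => zi zk zj N_le; clearbody delta => *.
  by rewrite ler_norml; apply/andP; split; lra.
have uj : `|u N i - u N j| <= eta%:C *+ (3 * d.+1).
  rewrite -sz_rs; apply: (@small_steps_near_points _ _ rs) => //.
  - by rewrite lecR ltW.
  - move=> k /andP[ik kj].
    apply: (close _ _ _ (nr_step _ (z N k.+1) _ (z01 k _) (u_root N k))).
      by rewrite ik ltnW.
    have -> : z N k - z N k.+1 = - N.+1%:R^-1.
      by rewrite /z -mulrBl -natr1 opprD addrA subrr sub0r mulN1r.
    rewrite normrN ger0_norm ?invr_ge0 // (le_trans N_le) //.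
    by rewrite ler_peMl ?ler1n // ltW.
  move=> k ikj; exists (nr (x, u N k)); last exact: u_near.
  by have := nr_root x (u N k); rewrite Drs root_prod_XsubC.
have tjy : `|u N j - nr (y, u N j)| <= eta%:C.
  apply: (close _ _ _ (nr_step _ y _ (z01 j _) (u_root N j))); first by rewrite ij leqnn.
  move: (N.+1%:R^-1) (z N j) N_le zj_le lt_zj => w zj N_le; clearbody delta => *.
  by rewrite ler_norml; apply/andP; split; lra.
have txi := u_near i ltac:(by rewrite leqnn).
have -> : eps%:C = eta%:C *+ (3 * d.+1) + eta%:C *+ 2.
  rewrite -mulrnDr -/K -rmorphMn; congr (_%:C).
  by rewrite /eta -mulr_natr divfK // pnatr_eq0.
apply: le_trans (ler_distD (u N i) _ _) _; rewrite distrC mulr2n addrCA lerD //.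
by apply: le_trans (ler_distD (u N j) _ _) _; rewrite lerD.
Qed.
End LiftRoots.

(** * Extension and gluing of continuous lifts *)

Section Lifts.
Variable R : realType.
Implicit Types (a e : {poly R[i]}) (x y : R).

Lemma near_dist_le (x eps : R) : 0 < eps -> \forall y \near x, `|x - y| <= eps.
Proof. by move=> eps_gt0; exact: (@cvgr_dist_le _ _ _ _ _ id x (@cvg_id _ _)). Qed.

Lemma continuous_real_complex : continuous (fun x => x%:C : R[i]^o).
Proof.
move=> x; apply/cvgrPdist_le => _ /gt0_complex_real [eps eps_gt0 ->].
near=> y; rewrite -rmorphB normC_real lecR.
by near: y; exact: near_dist_le.
Unshelve. all: by end_near. Qed.

(** Retraction of the line onto [[u, v]] for [u <= v]; composing with it turns continuity on the
    segment into continuity everywhere. *)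
Definition clamp (u v x : R) := Num.min v (Num.max u x).

Lemma clamp_itv u v x : u <= v -> u <= clamp u v x <= v.
Proof. by move=> uv; rewrite /clamp le_min ge_min uv le_max !lexx. Qed.

Lemma clamp_id u v x : u <= x <= v -> clamp u v x = x.
Proof. by move=> /andP[ux xv]; rewrite /clamp (max_idPr ux) (min_idPr xv). Qed.

Lemma clamp_lipschitz u v x y : u <= v -> `|clamp u v x - clamp u v y| <= `|x - y|.
Proof.
move=> uv; wlog xy : x y / x <= y.
  by move=> H; have [/H//|/ltW/H] := leP x y; rewrite distrC (distrC x).
have -> : `|x - y| = y - x by rewrite ler0_norm ?opprB ?subr_le0.
rewrite /clamp; case: (leP u x) => ux; case: (leP u y) => uy;
  case: (leP v _) => vx; try case: (leP v _) => vy;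
  rewrite ler_norml; apply/andP; split; lra.
Qed.

Lemma continuous_clamp u v : u <= v -> continuous (clamp u v).
Proof.
move=> uv x; apply/cvgrPdist_le => eps eps_gt0; near=> y.
apply: le_trans (clamp_lipschitz x y uv) _.
by near: y; exact: near_dist_le.
Unshelve. all: end_near. Qed.

Lemma within_continuous_clamp (V : topologicalType) (f : R -> V) u v : u <= v ->
  {within `[u, v], continuous f} -> continuous (f \o clamp u v).
Proof.
move=> uv cf x; have in_uv y : `[u, v]%classic (clamp u v y).
  by rewrite /= in_itv /= clamp_itv.
have cfx : f y @[y --> within `[u, v] (nbhs (clamp u v x))] --> f (clamp u v x).
  by rewrite nbhs_subspace_in //; exact: cf.
apply: cvg_comp cfx => A wA.
have : nbhs x (clamp u v @^-1` (fun y => `[u, v]%classic y -> A y)).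
  exact: (continuous_clamp uv wA).
by apply: (@filterS _ (nbhs x)) => y H; exact: H (in_uv y).
Qed.

Lemma continuous_glue (V : topologicalType) (f g : R -> V) x0 : f x0 = g x0 ->
  continuous f -> continuous g -> continuous (fun x => if x <= x0 then f x else g x).
Proof.
move=> fg cf cg x A hA.
have cfA : nbhs (f x) A -> \forall y \near x, A (f y) by exact: cf.
have cgA : nbhs (g x) A -> \forall y \near x, A (g y) by exact: cg.
suff : \forall y \near x, A (if y <= x0 then f y else g y) by [].
case: (ltgtP x x0) hA cfA cgA => [xx0|x0x|->] hA cfA cgA.
- have near_lt : \forall y \near x, y < x0.
    by apply: (@cvgr_lt _ _ _ _ id x (@cvg_id _ _)).
  apply: (filterS2 _ _ near_lt (cfA hA)) => y /ltW y_le Ay.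
  by rewrite /= y_le.
- have near_gt : \forall y \near x, x0 < y.
    by apply: (@cvgr_gt _ _ _ _ id x (@cvg_id _ _)).
  apply: (filterS2 _ _ near_gt (cgA hA)) => y y_gt Ay.
  by rewrite /= leNgt y_gt.
apply: (filterS2 _ _ (cfA hA) (cgA _)) => [y Ay By|]; by [case: ifP|rewrite -fg].
Qed.

(** An affine change of parameter reduces this to [lift_roots], for the pencil starting at
    [a - x1 e] with direction [(x2 - x1) e]. Since [x2 < x1] is allowed, roots are also continued
    backwards. *)
Lemma lift_roots_between a e x1 x2 t1 :
  0 <= x1 <= 1 -> 0 <= x2 <= 1 ->
  a \is monic -> (size e < size a)%N -> root (a - x1%:C *: e) t1 ->
  exists t : R -> R[i]^o,
    [/\ continuous t, t x1 = t1
      & forall x, Num.min x1 x2 <= x <= Num.max x1 x2 -> root (a - x%:C *: e) (t x)].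
Proof.
move=> x1_01 x2_01 a_monic e_lt t1_root.
have sz_xe x : (size (- (x%:C *: e)) < size a)%N.
  by rewrite size_polyN (leq_ltn_trans (size_scale_leq _ _)).
have [||t [t0 t_root t_cont]] :=
  @lift_roots R (a - x1%:C *: e) ((x2 - x1)%:C *: e) t1 _ _ t1_root.
- by rewrite monicE lead_coefDl // -monicE.
- by rewrite size_polyDl // (leq_ltn_trans (size_scale_leq _ _)).
have c01 x : 0 <= clamp 0 1 x <= 1 by rewrite clamp_itv.
have ct : continuous (t \o clamp 0 1 : R -> R[i]^o).
  move=> x; apply/cvgrPdist_le => _ /gt0_complex_real [eps eps_gt0 ->].
  have [delta delta_gt0 tP] := t_cont _ eps_gt0.
  near=> y; apply: tP => //.
  apply: le_trans (clamp_lipschitz x y ler01) _; near: y; exact: near_dist_le.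
exists (fun x => t (clamp 0 1 ((x - x1) / (x2 - x1)))); split.
- move=> x; apply: (@cvg_comp _ _ _ (fun x => (x - x1) / (x2 - x1))
    (t \o clamp 0 1) _ _ _ _ (ct _)).
  exact: (cvgM (cvgB (@cvg_id _ _) (cvg_cst _)) (cvg_cst _)).
- by rewrite subrr mul0r clamp_id ?lexx ?ler01.
move=> x x_btw; have -> : a - x%:C *: e =
    a - x1%:C *: e - ((x - x1) / (x2 - x1))%:C *: ((x2 - x1)%:C *: e).
  rewrite scalerA -rmorphM -addrA -opprD -scalerDl -rmorphD.
  (* If [x1 = x2], the quotient is 0 by convention and the bounds force [x = x1]. *)
  congr (_ - _%:C *: _); have [x12|x12] := eqVneq x2 x1.
    by move: x_btw; rewrite x12 minxx maxxx subrr mulr0 addr0 => /le_anti.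
  by rewrite divfK ?subr_eq0 // addrC subrK.
set y := _ / _; have y01 : 0 <= y <= 1.
  move: x_btw; rewrite /y; case: (ltgtP x1 x2) => [x12|x21|->] /andP[xl xr].
  - have d_gt0 : 0 < x2 - x1 by rewrite subr_gt0.
    by rewrite ler_pdivrMr // mul1r lerD2r xr divr_ge0 ?subr_ge0 // ltW.
  - have d_gt0 : 0 < x1 - x2 by rewrite subr_gt0.
    rewrite -mulrNN -invrN !opprB ler_pdivrMr // mul1r lerD2l lerN2 xl.
    by rewrite divr_ge0 ?subr_ge0 // ltW.
  - by rewrite subrr invr0 mulr0 lexx ler01.
by rewrite clamp_id //; apply: t_root.
Unshelve. all: by end_near. Qed.
End Lifts.

(** * Root loci from lifted roots *)

Section Pencil.
Variables (F : fieldType) (c : F) (n : nat).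
Implicit Types (q A B : {poly F}).

(* t^n q(c + 1/t) as a polynomial in t. *)
Definition inversion q : {poly F} :=
  \poly_(i < n.+1) (q \Po ('X + c%:P))`_(n - i).

Lemma size_translate q : size (q \Po ('X + c%:P)) = size q.
Proof. by rewrite size_comp_poly2 // size_XaddC. Qed.

Lemma horner_inversion q t : (size q <= n.+1)%N -> t != 0 ->
  (inversion q).[t] = t ^+ n * q.[c + t^-1].
Proof.
move=> size_q t_neq0; rewrite horner_poly (reindex_inj rev_ord_inj) /=.
have -> : q.[c + t^-1] = (q \Po ('X + c%:P)).[t^-1].
  by rewrite horner_comp !hornerE addrC.
rewrite (horner_coef_wide (n := n.+1)) ?size_translate // mulr_sumr.
apply: eq_bigr => i _; have i_le : (i <= n)%N by rewrite -ltnS.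
by rewrite subSS subKn // mulrCA exprVn expfB_cond // (negPf t_neq0).
Qed.

(** The value [t = 0] stands for [s] at infinity, where only the leading coefficient counts;
    translation preserves it. *)
Lemma inversion0 q : size q = n.+1 -> (inversion q).[0] = lead_coef q.
Proof.
move=> size_q; rewrite horner_coef0 coef_poly subn0 /=.
have := @lead_coef_comp _ q ('X + c%:P); rewrite size_XaddC => /(_ isT).
rewrite lead_coefXaddC expr1n mulr1 => <-.
by rewrite lead_coefE size_translate size_q.
Qed.

Lemma coef_inversion q : (inversion q)`_n = q.[c].
Proof.
by rewrite coef_poly leqnn subnn -horner_coef0 horner_comp !hornerE.
Qed.

(* Moving a point c with A(c) + B(c) = 0 to infinity makes the pencil
   (1 - x) A - x B monic of constant degree for all x. *)
Lemma monic_pencil A B : (0 < n)%N -> size A = n.+1 -> size B = n.+1 ->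
  A.[c] + B.[c] = 0 -> A.[c] != 0 ->
  exists a e : {poly F},
    [/\ a \is monic, (size e < size a)%N,
        forall x t, t != 0 ->
          root (a - x *: e) t = ((1 - x) * A.[c + t^-1] == x * B.[c + t^-1])
      & forall x,
          root (a - x *: e) 0 = ((1 - x) * lead_coef A == x * lead_coef B)].
Proof.
move=> n_gt0 size_A size_B ABc Ac_neq0; pose k := A.[c]^-1.
have k_neq0 : k != 0 by rewrite invr_eq0.
(* Then [a - x e] is [k ((1 - x) inversion A - x inversion B)], and the coefficient of degree [n] of
   [e] is [k (A(c) + B(c)) = 0]. *)
pose a := k *: inversion A; pose e := k *: (inversion A + inversion B).
have an : a`_n = 1 by rewrite coefZ coef_inversion mulVf.
have size_a : size a = n.+1.
  apply/eqP; rewrite eqn_leq; apply/andP; split.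
    by rewrite (leq_trans (size_scale_leq _ _)) // size_poly.
  rewrite ltnNge; apply/negP => /leq_sizeP/(_ n (leqnn n))/eqP.
  by rewrite an oner_eq0.
have rootE x t : root (a - x *: e) t =
    ((1 - x) * (inversion A).[t] == x * (inversion B).[t]).
  rewrite rootE /a /e hornerD hornerN !hornerZ hornerD -[RHS]subr_eq0.
  rewrite -[RHS](mulrI_eq0 _ (lregP k_neq0)).
  by congr (_ == _); ring.
exists a, e; split.
- by rewrite monicE lead_coefE size_a an.
- rewrite size_a ltnS; apply/leq_sizeP => j; rewrite leq_eqVlt => /predU1P[<-|nj].
    by rewrite coefZ coefD !coef_inversion ABc mulr0.
  by rewrite coefZ coefD !coef_poly ltnS leqNgt nj /= addr0 mulr0.
- move=> x t t_neq0; rewrite rootE !horner_inversion ?size_A ?size_B //.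
  rewrite -subr_eq0 -[RHS]subr_eq0.
  rewrite -[RHS](mulrI_eq0 _ (lregP (expf_neq0 n t_neq0))).
  by congr (_ == _); ring.
- by move=> x; rewrite rootE !inversion0.
Qed.
End Pencil.

(** The arc is prolonged by a lift from [x1] back to 0 and by a lift from [x2] on to 1, glued at its
    end points. *)
Lemma lift_through_arc (R : realType) (a e : {poly R[i]}) (arc : R -> R[i]^o) x1 x2 :
  a \is monic -> (size e < size a)%N -> 0 <= x1 -> x1 <= x2 -> x2 <= 1 ->
  continuous arc ->
  (forall x, x1 <= x <= x2 -> root (a - x%:C *: e) (arc x)) ->
  exists t : R -> R[i]^o,
    [/\ continuous t, forall x, x1 <= x <= x2 -> t x = arc x
      & forall x, 0 <= x <= 1 -> root (a - x%:C *: e) (t x)].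
Proof.
move=> a_monic e_lt x1_ge0 x12 x2_le1 arc_cont arc_root.
have x1_01 : 0 <= x1 <= 1 by rewrite x1_ge0 (le_trans x12).
have x2_01 : 0 <= x2 <= 1 by rewrite x2_le1 (le_trans x1_ge0).
have r1 := arc_root x1; rewrite lexx x12 in r1.
have r2 := arc_root x2; rewrite lexx x12 in r2.
have x00 : 0 <= (0 : R) <= 1 by rewrite lexx ler01.
have x11 : 0 <= (1 : R) <= 1 by rewrite lexx ler01.
have [b [b_cont bx1 b_root]] := lift_roots_between x1_01 x00 a_monic e_lt (r1 isT).
have [f [f_cont fx2 f_root]] := lift_roots_between x2_01 x11 a_monic e_lt (r2 isT).
exists (fun x => if x <= x1 then b x else if x <= x2 then arc x else f x); split.
- apply: (@continuous_glue R _ b (fun x => if x <= x2 then arc x else f x)).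
  + by rewrite x12 bx1.
  + exact: b_cont.
  + exact: (@continuous_glue R _ arc f x2 (esym fx2) arc_cont f_cont).
- move=> x /andP[x1x xx2]; rewrite xx2; case: ifP => // xx1.
  by have -> : x = x1 by apply/eqP; rewrite eq_le xx1.
move=> x /andP[x_ge0 x_le1]; case: (leP x x1) => xx1.
  by apply: b_root; rewrite min_r // max_l // x_ge0.
case: (leP x x2) => xx2; first by apply: arc_root; rewrite ltW.
by apply: f_root; rewrite min_l // max_r // ltW.
Qed.

(** * Compactified gain and behaviour at infinity *)

Section GainCompactification.
Variable R : realType.
Implicit Types (k x : R) (s c : R[i]).

(* Compactifies the range [0, +oo] of the gain to [0, 1]. *)
Definition gain01 k : R := k / (1 + k).

Lemma gain01_cvg k : 0 <= k -> gain01 @ k --> gain01 k.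
Proof.
move=> k_ge0; apply: cvgM; first exact: cvg_id.
apply: cvgV; first by rewrite gt_eqF // ltr_pwDl.
by apply: cvgD; [exact: cvg_cst|exact: cvg_id].
Qed.

Lemma gain01_cvg_pinfty : gain01 @ +oo --> (1 : R).
Proof.
apply/cvgrPdist_le => eps eps_gt0; near=> k.
have k_gt0 : 0 < k by near: k; apply: nbhs_pinfty_gt; rewrite num_real.
have k1_gt0 : 0 < 1 + k by rewrite addr_gt0.
have -> : 1 - gain01 k = (1 + k)^-1.
  by rewrite /gain01; field; rewrite gt_eqF.
rewrite ger0_norm ?invr_ge0; last exact: ltW.
rewrite invf_ple ?posrE //.
have : eps^-1 <= k by near: k; apply: nbhs_pinfty_ge; rewrite num_real.
by move=> /le_trans; apply; rewrite lerDr.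
Unshelve. all: end_near. Qed.

Lemma gain01_itv k : 0 < k -> 0 < gain01 k < 1.
Proof.
move=> k_gt0; have k1_gt0 : 0 < 1 + k by rewrite addr_gt0.
by rewrite divr_gt0 //= ltr_pdivrMr // mul1r ltrDr.
Qed.

Lemma ler_gain01 k l : 0 <= k -> 0 <= l -> (gain01 k <= gain01 l) = (k <= l).
Proof.
move=> k_ge0 l_ge0; have k1_gt0 : 0 < 1 + k by rewrite ltr_pwDl.
have l1_gt0 : 0 < 1 + l by rewrite ltr_pwDl.
rewrite ler_pdivrMr // mulrAC ler_pdivlMr // !mulrDr !mulr1 (mulrC l).
by rewrite lerD2r.
Qed.

Lemma ltr_gain01 k l : 0 <= k -> 0 <= l -> (gain01 k < gain01 l) = (k < l).
Proof. by move=> k_ge0 l_ge0; rewrite !ltNge ler_gain01. Qed.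

Lemma gain01_inj : {in [pred k | 0 <= k] &, injective gain01}.
Proof.
move=> k l; rewrite !inE => k_ge0 l_ge0 /eqP.
by rewrite eq_le !ler_gain01 // -eq_le => /eqP.
Qed.

Lemma inv_to_infinity (F : set_system R) (u : R -> R[i]^o) c : Filter F ->
  u k @[k --> F] --> (0 : R[i]^o) -> (\forall k \near F, u k != 0) ->
  to_infinity F (fun k => c + (u k)^-1).
Proof.
move=> FF u0 un0; apply/cvgryPge => M.
have [m mE] : exists m : R, `|c| = m%:C by eexists; rewrite normc_def.
have m_ge0 : 0 <= m by rewrite -lecR -mE normr_ge0.
(* [|1/u| >= M'] gives [|c + 1/u| >= M' - |c| > M]. *)
pose M' := `|M| + m + 1; have M'_gt0 : 0 < M' by rewrite ltr_wpDl // addr_ge0.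
near=> k.
have uk_neq0 : u k != 0 by near: k.
have uk_le : `|u k| <= (M'^-1)%:C.
  rewrite -normrN -sub0r; near: k; apply: cvgr_dist_le => //.
  by rewrite ltcR invr_gt0.
have [v vE] : exists v : R, `|(u k)^-1| = v%:C by eexists; rewrite normc_def.
have [w wE] : exists w : R, `|c + (u k)^-1| = w%:C by eexists; rewrite normc_def.
have M'v : M' <= v.
  rewrite -lecR -vE normfV -(invrK M') fmorphV lef_pV2 //.
  + by rewrite posrE ltcR invr_gt0.
  + by rewrite posrE normr_gt0.
have vwm : v <= w + m.
  rewrite -lecR; have -> : (w + m)%:C = w%:C + m%:C by rewrite rmorphD.
  rewrite -vE -wE -mE.
  by rewrite -[X in `|X| <= _](addKr c) addrC; apply: ler_normB.
rewrite wE /=; have := ler_norm M; rewrite /M' in M'v; lra.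
Unshelve. all: end_near. Qed.
End GainCompactification.

Section LocusOfLift.
Variables (R : realType) (p : {poly R}) (c : R[i]) (t : R -> R[i]^o) (kinf : R).
Hypothesis pole_not_zero : forall s, is_pole p s -> ~ is_zero p s.
Hypothesis t_cont : continuous t.
Hypothesis t_root : forall x, 0 <= x <= 1 -> t x != 0 ->
  (1 - x%:C) * ceval (PPden p) (c + (t x)^-1)
    = x%:C * ceval (PPnum p) (c + (t x)^-1).
Hypothesis kinf_gt0 : 0 < kinf.
Hypothesis t_eq0 : forall x, 0 <= x <= 1 -> t x = 0 -> x = gain01 kinf.

Let curve k : R[i]^o := c + (t (gain01 k))^-1.

Let t_neq0 k : 0 < k -> k != kinf -> t (gain01 k) != 0.
Proof.
move=> k_gt0; apply: contraNneq => tk0; apply/eqP.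
have /andP[/ltW k0 /ltW k1] := gain01_itv k_gt0.
by apply: gain01_inj; rewrite ?inE ?ltW //; apply: t_eq0; rewrite ?k0.
Qed.

Let curve_equation k : 0 < k -> t (gain01 k) != 0 ->
  k%:C * PP p (curve k) = (-1) ^+ false.
Proof.
move=> k_gt0 tk_neq0; have /andP[/ltW k0 /ltW k1] := gain01_itv k_gt0.
have := t_root _ tk_neq0; rewrite k0 k1 => /(_ isT); rewrite -/(curve k).
have kC_neq0 : k%:C != 0 by rewrite gt_eqF // ltcR.
have k1_neq0 : (1 + k)%:C != 0 by rewrite gt_eqF // ltcR ltr_pwDl ?ltW.
have -> : (gain01 k)%:C = k%:C / (1 + k)%:C by rewrite -fmorphV -rmorphM.
have -> : 1 - k%:C / (1 + k)%:C = (1 + k)%:C^-1.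
  by rewrite rmorphD /=; field; rewrite -rmorphD.
move=> /(congr1 (fun s => (1 + k)%:C * s)); rewrite mulVKf // => AkB.
have {}AkB : ceval (PPden p) (curve k) = k%:C * ceval (PPnum p) (curve k).
  by rewrite AkB mulrA mulrCA divff // mulr1.
(* If the denominator vanished, so would the numerator, as [k] is not 0. *)
have A_neq0 : ceval (PPden p) (curve k) != 0.
  apply/eqP => A0; apply: (pole_not_zero A0); move/eqP: AkB.
  by rewrite A0 eq_sym mulf_eq0 (negPf kC_neq0) => /eqP.
by rewrite expr0 /PP mulrA -AkB divff.
Qed.

Let curve_cvg (F : set_system R) (x : R) : Filter F ->
  gain01 k @[k --> F] --> x -> t x != 0 ->
  curve k @[k --> F] --> (c + (t x)^-1 : R[i]^o).
Proof.
move=> FF gx tx_neq0; apply: cvgD; first exact: cvg_cst.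
have tx : t (gain01 k) @[k --> F] --> t x by apply: cvg_comp gx (@t_cont x).
exact: (cvgV tx_neq0 tx).
Qed.

Let curve_cont k : 0 < k -> t (gain01 k) != 0 -> {for k, continuous curve}.
Proof. by move=> k_gt0; apply: curve_cvg; apply: gain01_cvg; apply: ltW. Qed.

(** At [x = 0] the equation of the pencil reduces to [PPden = 0], so the limit is a pole; it is
    finite because [t] can vanish only at [gain01 kinf > 0]. *)
Let curve_starts :
  exists2 s : R[i]^o, is_pole p s & curve k @[k --> (0 : R)^'+] --> s.
Proof.
have t0 : t 0 != 0.
  apply/eqP => /t_eq0; rewrite lexx ler01 => /(_ isT)/esym/eqP.
  by rewrite gt_eqF //; case/andP: (gain01_itv kinf_gt0).
exists (c + (t 0)^-1).
  have := t_root _ t0; rewrite lexx ler01 => /(_ isT).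
  by rewrite subr0 mul1r mul0r.
apply: curve_cvg => //; apply: cvg_at_right_filter.
by have := gain01_cvg (lexx (0 : R)); rewrite {2}/gain01 mul0r.
Qed.

Let curve_ends :
  exists2 s : R[i]^o, is_zero p s & curve k @[k --> +oo] --> s.
Proof.
have t1 : t 1 != 0.
  apply/eqP => /t_eq0; rewrite lexx ler01 => /(_ isT)/eqP.
  by rewrite gt_eqF //; case/andP: (gain01_itv kinf_gt0).
exists (c + (t 1)^-1).
  have := t_root _ t1; rewrite lexx ler01 => /(_ isT).
  by rewrite subrr mul1r mul0r => /esym.
by apply: curve_cvg => //; exact: gain01_cvg_pinfty.
Qed.

Let curve_infinity (F : set_system R) : Filter F -> t (gain01 kinf) = 0 ->
  k @[k --> F] --> kinf -> (\forall k \near F, 0 < k /\ k != kinf) ->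
  to_infinity F curve.
Proof.
move=> FF tinf Fk Fneq; apply: inv_to_infinity.
  rewrite -tinf; have gF : gain01 k @[k --> F] --> gain01 kinf.
    by apply: cvg_comp Fk (gain01_cvg (ltW kinf_gt0)).
  by apply: cvg_comp gF (@t_cont _).
by apply: filterS Fneq => k [k_gt0 k_neq]; apply: t_neq0.
Qed.

(** The curve can meet infinity only at the gain [kinf]. If it does, it is cut there, and the piece
    whose gains contain [km] is kept: it runs from a pole to infinity or from infinity to a zero.
    Otherwise all positive gains are kept. *)
Lemma locus_of_lift km : 0 < km -> t (gain01 km) != 0 ->
  exists L : root_locus p, ((rl_from L)%:E < km%:E < rl_to L)%E /\
    forall k, rl_curve L k = c + (t (gain01 k))^-1.
Proof.
move=> km_gt0 tkm; have [tinf|tinf] := eqVneq (t (gain01 kinf)) 0; last first.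
  have t_neq0' k : 0 < k -> t (gain01 k) != 0.
    by have [->|] := eqVneq k kinf => // kk k_gt0; apply: t_neq0.
  unshelve eexists (@RootLocus R p false 0 +oo%E curve _ _ _ _ _ _) => //.
  - by rewrite ltry.
  - move=> k /andP[]; rewrite lte_fin => k_gt0 _.
    by apply: curve_equation => //; apply: t_neq0'.
  - move=> k /andP[]; rewrite lte_fin => k_gt0 _.
    by apply: curve_cont => //; apply: t_neq0'.
  - by left.
  - by left.
  by rewrite /= lte_fin km_gt0 ltry.
case: (ltgtP km kinf) tkm => [km_lt|lt_km|->]; last by rewrite tinf eqxx.
  move=> _; unshelve eexists (@RootLocus R p false 0 kinf%:E curve _ _ _ _ _ _) => //.
  - move=> k /andP[]; rewrite !lte_fin => k_gt0 k_lt.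
    by apply: curve_equation => //; apply: t_neq0; rewrite // lt_eqF.
  - move=> k /andP[]; rewrite !lte_fin => k_gt0 k_lt.
    by apply: curve_cont => //; apply: t_neq0; rewrite // lt_eqF.
  - by left.
  - right; apply: curve_infinity => //=.
      exact: at_left_proper_filter.
      exact: (@cvg_at_left_filter _ _ id _ _ (@cvg_id _ _)).
    near=> k; split; last by rewrite lt_eqF.
    by near: k; exact: nbhs_left_gt.
  by rewrite /= !lte_fin km_gt0.
move=> _; unshelve eexists (@RootLocus R p false kinf +oo%E curve _ _ _ _ _ _) => //.
- exact: ltW.
- by rewrite ltry.
- move=> k /andP[]; rewrite lte_fin => k_gt _.
  have k_gt0 := lt_trans kinf_gt0 k_gt.
  by apply: curve_equation => //; apply: t_neq0; rewrite // gt_eqF.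
- move=> k /andP[]; rewrite lte_fin => k_gt _.
  have k_gt0 := lt_trans kinf_gt0 k_gt.
  by apply: curve_cont => //; apply: t_neq0; rewrite // gt_eqF.
- right; apply: curve_infinity => //=.
    exact: (@cvg_at_right_filter _ _ id _ _ (@cvg_id _ _)).
  near=> k; have k_gt : kinf < k by [].
  by rewrite (lt_trans kinf_gt0) // gt_eqF.
- by left.
by rewrite /= lte_fin lt_km ltry.
Unshelve. all: end_near. Qed.
End LocusOfLift.

(** * Real branches of the gain *)

Section Fraction.
Variables (R : realType) (A D : {poly R}).
Hypotheses (D_neq0 : forall x, D.[x] != 0) (coprime_AD : coprimep A D).
Hypothesis size_A : (1 < size A)%N.

Definition fraction x : R := A.[x] / D.[x].

Lemma fraction_continuous : continuous fraction.
Proof.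
move=> x; apply: cvgM; first exact: continuous_horner.
by apply: cvgV; [exact: D_neq0|exact: continuous_horner].
Qed.

Let wronskian := A^`() * D - A * D^`().

(** This is the numerator of the derivative of [A / D]. If it vanished, [A] would divide [A^]() *
    D[, hence]A^[()] by coprimality, against the degrees. *)
Let wronskian_neq0 : wronskian != 0.
Proof.
have A_neq0 : A != 0 by rewrite -size_poly_gt0 ltnW.
rewrite subr_eq0; apply/eqP => AD; have : A %| A^`().
  by rewrite -(Gauss_dvdpl _ coprime_AD) AD dvdp_mulr.
have A'_neq0 : A^`() != 0.
  by rewrite -size_poly_gt0 size_deriv; case: (size A) size_A => [|[]].
move=> /(dvdp_leq A'_neq0); rewrite size_deriv.
by case: (size A) size_A => // m _; rewrite ltnn.
Qed.

Let is_derive_fraction x : is_derive x (1 : R) fraction (wronskian.[x] / D.[x] ^+ 2).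
Proof.
have dD := is_deriveV (D_neq0 x) (is_derive_poly D x).
apply: is_derive_eq (is_deriveM (is_derive_poly A x) dD) _.
rewrite /wronskian !hornerE /GRing.scale /=. field; exact: D_neq0.
Qed.

Let fraction_injective u v : {in `]u, v[%R, forall x, ~~ root wronskian x} ->
  {in `[u, v]%R &, injective fraction}.
Proof.
move=> noroot x y.
wlog xy : x y / x < y.
  move=> H x_uv y_uv fxy; case: (ltgtP x y) => // [xy|yx]; first exact: H.
  by apply/esym/H.
rewrite !in_itv /= => /andP[ux xv] /andP[uy yv] fxy; exfalso.
have [z|z /[!in_itv] /andP[xz zy] dz0] :=
    Rolle xy _ (continuous_subspaceT fraction_continuous) fxy.
  by move=> _; have [] := is_derive_fraction z.
have [_ dz] := is_derive_fraction z; have [_ dz0'] := dz0.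
move: dz; rewrite dz0' => /esym/eqP.
rewrite mulf_eq0 invr_eq0 expf_eq0 /= (negPf (D_neq0 z)) orbF => rz.
have /negP[] : ~~ root wronskian z; last exact: rz.
by apply: noroot; rewrite in_itv /= (le_lt_trans ux xz) (lt_le_trans zy yv).
Qed.

Lemma fraction_injective_right x :
  exists2 v, x < v & {in `[x, v]%R &, injective fraction}.
Proof.
(* Up to the next zero of the derivative, or up to [x + 1] if there is none before, Rolle's theorem
   excludes equal values. *)
exists (next_root wronskian x (x + 1)).
  by apply: next_root_gt; rewrite ?ltrDl.
by apply: fraction_injective; exact: next_noroot.
Qed.

Lemma fraction_injective_left x :
  exists2 u, u < x & {in `[u, x]%R &, injective fraction}.
Proof.
exists (prev_root wronskian (x - 1) x).
  by apply: prev_root_lt; rewrite // ltrBlDr ltrDl.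
by apply: fraction_injective; exact: prev_noroot.
Qed.
End Fraction.

(** Injectivity and continuity suffice, whether [f] increases or decreases: the intermediate value
    theorem gives the range, and the inverse is continuous on it. Clamping to [[lo, hi]] makes the
    continuity global. *)
Lemma segment_inverse (R : realType) (f : R -> R) u v : u <= v ->
  continuous f -> {in `[u, v]%R &, injective f} ->
  exists g : R -> R, {in `[u, v]%R, cancel f g} /\
    forall lo hi, lo <= hi -> Num.min (f u) (f v) <= lo ->
      hi <= Num.max (f u) (f v) ->
      continuous (g \o clamp lo hi) /\
      forall z, lo <= z <= hi -> g z \in `[u, v]%R /\ f (g z) = z.
Proof.
move=> uv f_cont f_inj; have f_within := continuous_subspaceT f_cont (A := `[u, v]).
have /choice [g gP] : forall z, exists x,
    (exists2 y, y \in `[u, v]%R & f y = z) -> x \in `[u, v]%R /\ f x = z.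
  move=> z; have [[y y_uv fy]|no] := pselect (exists2 y, y \in `[u, v]%R & f y = z).
    by exists y.
  by exists u.
have gK : {in `[u, v]%R, cancel f g}.
  move=> x x_uv; have [|g_uv fg] := gP (f x); first by exists x.
  exact: f_inj.
exists g; split=> // lo hi lo_hi lo_ge hi_le; split; last first.
  move=> z /andP[lo_z z_hi]; apply: gP; have [|c] := IVT uv f_within (v := z).
    by rewrite (le_trans lo_ge) // (le_trans z_hi).
  by move=> c_uv <-; exists c.
apply: within_continuous_clamp => //.
apply: continuous_subspaceW (segment_can_continuous uv f_within gK).
by apply: subset_itv; rewrite bnd_simp.
Qed.

Lemma ceval_real (R : realType) (q : {poly R}) (x : R) : ceval q x%:C = (q.[x])%:C.
Proof. exact: horner_map. Qed.

(** * Real branches extended to root loci, and the maximum of the gain *)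

Section RealBranch.
Variables (R : realType) (p : {poly R}) (kinf : R).
Hypothesis ppp_gt0 : forall x, 0 < (p^`(2) * p).[x].
Hypothesis size_eq : size (p^`() ^+ 2) = size (p^`(2) * p).
Hypothesis kinf_gt0 : 0 < kinf.
Hypothesis lead_eq : lead_coef (p^`() ^+ 2) = kinf * lead_coef (p^`(2) * p).
Hypothesis critical : exists x, root p^`() x.

Let A := PPden p.
Let B := PPnum p.
Let G := PPgcd p.

Let AG : A * G = p^`() ^+ 2.
Proof. by rewrite divpK // dvdp_gcdr. Qed.

Let BG : B * G = p^`(2) * p.
Proof. by rewrite divpK // dvdp_gcdl. Qed.

Let BxGx_gt0 x : 0 < B.[x] * G.[x].
Proof. by rewrite -hornerM BG. Qed.

Let Gx_neq0 x : G.[x] != 0.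
Proof. by apply: contraTneq (BxGx_gt0 x) => ->; rewrite mulr0 ltxx. Qed.

Let Bx_neq0 x : B.[x] != 0.
Proof. by apply: contraTneq (BxGx_gt0 x) => ->; rewrite mul0r ltxx. Qed.

Let AxGx_ge0 x : 0 <= A.[x] * G.[x].
Proof. by rewrite -hornerM AG horner_exp sqr_ge0. Qed.

(** Multiplied by the gcd, the sum becomes [p'^2 + p'' p], which is positive. *)
Lemma PPden_add_PPnum_neq0 x : (A + B).[x] != 0.
Proof.
have := ltr_wpDl (AxGx_ge0 x) (BxGx_gt0 x); rewrite -mulrDl -hornerD.
by apply: contraTneq => ->; rewrite mul0r ltxx.
Qed.

(** The real gain [A / B] in the coordinate [k / (1 + k)] of the pencil. *)
Definition gain_fraction : R -> R := fraction A (A + B).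

Let f := gain_fraction.

Lemma gain_fractionE x :
  f x = p^`().[x] ^+ 2 / (p^`().[x] ^+ 2 + (p^`(2) * p).[x]).
Proof.
rewrite -horner_exp -AG -BG !hornerM -mulrDl -hornerD -mulf_div divff //.
by rewrite mulr1.
Qed.

Let f_itv x : 0 <= f x < 1.
Proof.
have D_gt0 : 0 < p^`().[x] ^+ 2 + (p^`(2) * p).[x].
  by rewrite ltr_wpDl ?sqr_ge0.
by rewrite gain_fractionE divr_ge0 ?sqr_ge0 ?ltW //= ltr_pdivrMr // mul1r ltrDl.
Qed.

Lemma gain01_PP x : gain01 (A.[x] / B.[x]) = f x.
Proof.
have := PPden_add_PPnum_neq0 x.
rewrite /gain01 /f /gain_fraction /fraction hornerD => D_neq0.
by field; rewrite Bx_neq0 D_neq0.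
Qed.

Let G_neq0 : G != 0.
Proof. by apply: contraNneq (Gx_neq0 0) => ->; rewrite horner0. Qed.

Let B_neq0 : B != 0.
Proof. by apply: contraNneq (Bx_neq0 0) => ->; rewrite horner0. Qed.

Let A_neq0 : A != 0.
Proof.
have /eqP : p^`() ^+ 2 != 0.
  by rewrite -size_poly_gt0 size_eq -BG size_poly_gt0 mulf_neq0.
by move=> P0; apply/eqP => A0; apply: P0; rewrite -AG A0 mul0r.
Qed.

Let size_AB : size A = size B.
Proof.
move: size_eq; rewrite -AG -BG !size_mul //.
have : (0 < size G)%N by rewrite size_poly_gt0.
by move: (size A) (size B) (size G) => a b g; lia.
Qed.

Let lead_AB : lead_coef A = kinf * lead_coef B.
Proof.
move: lead_eq; rewrite -AG -BG !lead_coefM mulrA => /mulIf; apply.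
by rewrite lead_coef_eq0.
Qed.

Let size_A : (1 < size A)%N.
Proof.
have [x /rootP p'x] := critical; apply: (@root_size_gt1 _ x) => //.
apply/rootP/(mulIf (Gx_neq0 x)).
by rewrite -hornerM AG horner_exp p'x expr0n mul0r.
Qed.

Let coprime_BA : coprimep B A.
Proof.
by apply: coprimep_div_gcd; rewrite -BG mulf_neq0.
Qed.

Let coprime_AD : coprimep A (A + B).
Proof. by rewrite -{2}[A]mul1r coprimep_addl_mul coprimep_sym. Qed.

Let pole_not_zero s : is_pole p s -> ~ is_zero p s.
Proof.
move=> /rootP Ps /rootP Zs.
have : coprimep (map_poly (real_complex R) A) (map_poly (real_complex R) B).
  by rewrite coprimep_map coprimep_sym.
by move=> /coprimep_root/(_ Ps)/negP; apply.
Qed.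

(** Any complex root of [A + B] works. There is one because the leading coefficient of [A] is a
    positive multiple of that of [B], so that nothing cancels; it is not real by
    [PPden_add_PPnum_neq0]. *)
Let pencil_center : exists c : R[i],
  [/\ ceval A c + ceval B c = 0, ceval A c != 0 & forall x : R, c != x%:C].
Proof.
have size_D : size (A + B) = size A.
  pose m := (size A).-1.
  have lcA : A`_m = kinf * B`_m by rewrite -lead_coefE lead_AB lead_coefE -size_AB.
  have Bm_neq0 : B`_m != 0 by rewrite /m size_AB -lead_coefE lead_coef_eq0.
  apply/eqP; rewrite eqn_leq (leq_trans (size_polyD _ _)) ?size_AB ?maxnn //=.
  rewrite -size_AB -(prednK (ltnW size_A)) -/m ltnNge.
  apply/negP => /leq_sizeP/(_ m (leqnn m))/eqP.
  rewrite coefD lcA -{2}[B`_m]mul1r -mulrDl mulf_eq0 (negPf Bm_neq0) orbF.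
  by rewrite gt_eqF // addr_gt0.
have /closed_rootP [c /rootP c_root] :
    size (map_poly (real_complex R) (A + B)) != 1%N.
  by rewrite size_map_poly size_D; case: (size A) size_A => [|[]].
have ABc : ceval A c + ceval B c = 0 by rewrite /ceval -hornerD -rmorphD.
exists c; split=> //.
  apply/eqP => Ac; apply: (pole_not_zero Ac).
  by move: ABc; rewrite Ac add0r.
move=> x; apply: contraTneq (PPden_add_PPnum_neq0 x) => cx; rewrite negbK.
by rewrite -(inj_eq (@complexI R)) -ceval_real -cx /ceval c_root.
Qed.


Lemma gain_ge0 x : 0 <= A.[x] / B.[x].
Proof.
have -> : A.[x] / B.[x] = A.[x] * G.[x] / (B.[x] * G.[x]).
  by rewrite -mulf_div divff ?mulr1.
by rewrite divr_ge0 // ltW.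
Qed.

Lemma gain_real x : gain p x%:C = (A.[x] / B.[x])%:E.
Proof.
rewrite /gain !ceval_real !(inj_eq (@complexI R)) (negPf (Bx_neq0 x)).
case: eqVneq => [->|A_neq0']; first by rewrite mul0r.
by rewrite /PP !ceval_real -fmorph_div -fmorphV invf_div normC_real ger0_norm ?gain_ge0.
Qed.

(* The locus is the real inverse of the gain near xm, continued on both sides
   by arbitrary lifts. *)
Let real_branch (right : bool) u v
    (xm := if right then u else v) (y := if right then v else u) :
  u < v -> {in `[u, v]%R &, injective f} -> f y < f xm ->
  exists L : root_locus p,
    [/\ passes_at L (A.[xm] / B.[xm]) xm%:C
     & \forall k \near (A.[xm] / B.[xm])^'-, on_side right xm (rl_curve L k)].
Proof.
move=> uv f_inj fy_lt.
have f_cont : continuous f := fraction_continuous PPden_add_PPnum_neq0.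
have [fy_ge0 _] := andP (f_itv y); have [_ fxm_lt1] := andP (f_itv xm).
have [g [gK gP]] := segment_inverse (ltW uv) f_cont f_inj.
have f_min : Num.min (f u) (f v) <= f y.
  by rewrite /y; case: (right); rewrite ge_min lexx ?orbT.
have f_max : f xm <= Num.max (f u) (f v).
  by rewrite /xm; case: (right); rewrite le_max lexx ?orbT.
have {gP} [g_cont gP] := gP _ _ (ltW fy_lt) f_min f_max.
have [c [ABc Ac_neq0 c_nonreal]] := pencil_center.
have size_A' : size (map_poly (real_complex R) A) = (size A).-1.+1.
  by rewrite size_map_poly prednK // ltnW.
have size_B' : size (map_poly (real_complex R) B) = (size A).-1.+1.
  by rewrite size_map_poly -size_AB prednK // ltnW.
have size_pos : (0 < (size A).-1)%N by case: (size A) size_A => [|[]].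
have [a [e [a_monic e_lt root_ae root_ae0]]] :=
  monic_pencil size_pos size_A' size_B' ABc Ac_neq0.
(* The real branch [s = g z] in the coordinate [t = 1 / (s - c)], where [c] is not real. *)
pose arc z : R[i]^o := ((g (clamp (f y) (f xm) z))%:C - c)^-1.
have gc_neq0 z : (g z)%:C - c != 0 by rewrite subr_eq0 eq_sym.
have arc_cont : continuous arc.
  move=> z; apply: cvgV; first exact: gc_neq0.
  apply: cvgB; last exact: cvg_cst.
  apply: cvg_comp (g_cont z) (@continuous_real_complex R _).
have arcE z : c + (arc z)^-1 = (g (clamp (f y) (f xm) z))%:C.
  by rewrite invrK addrC subrK.
have arc_neq0 z : arc z != 0 by rewrite invr_eq0.
have arc_root z : f y <= z <= f xm -> root (a - z%:C *: e) (arc z).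
  move=> z_itv; rewrite root_ae // arcE clamp_id // -!/(ceval _ _) !ceval_real.
  have [_] := gP z z_itv; move: (g z) => x <-; apply/eqP.
  have := PPden_add_PPnum_neq0 x; rewrite /f /gain_fraction /fraction hornerD => D_neq0.
  have -> : 1 - (A.[x] / (A.[x] + B.[x]))%:C = (B.[x] / (A.[x] + B.[x]))%:C.
    by rewrite -(rmorph1 (real_complex R)) -rmorphB; congr (_%:C); field.
  by rewrite -!rmorphM; congr (_%:C); field.
have [t [t_cont t_arc t_root]] := lift_through_arc a_monic e_lt fy_ge0
  (ltW fy_lt) (ltW fxm_lt1) arc_cont arc_root.
have gkm : gain01 (A.[xm] / B.[xm]) = f xm := gain01_PP xm.
have km_gt0 : 0 < A.[xm] / B.[xm].
  rewrite lt_neqAle gain_ge0 andbT; apply: contraTneq fy_lt => km0.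
  by rewrite -gkm -km0 /gain01 mul0r -leNgt.
have txm : t (gain01 (A.[xm] / B.[xm])) = arc (f xm).
  by rewrite gkm t_arc // lexx ltW.
have t_pencil x : 0 <= x <= 1 -> t x != 0 ->
    (1 - x%:C) * ceval A (c + (t x)^-1) = x%:C * ceval B (c + (t x)^-1).
  by move=> x01 tx_neq0; have := t_root x x01; rewrite root_ae // => /eqP.
(* At [t = 0] the equation compares leading coefficients: [(1 - x) kinf = x]. *)
have t_infinity x : 0 <= x <= 1 -> t x = 0 -> x = gain01 kinf.
  move=> x01 tx0; have := t_root x x01; rewrite tx0 root_ae0 !lead_coef_map.
  rewrite lead_AB -(rmorph1 (real_complex R)) -rmorphB -!rmorphM.
  rewrite (inj_eq (@complexI R)) mulrA => /eqP/mulIf.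
  rewrite lead_coef_eq0 => /(_ B_neq0) xE.
  have k1_neq0 : 1 + kinf != 0 by rewrite gt_eqF // ltr_pwDl // ltW.
  by rewrite /gain01; apply: (mulIf k1_neq0); rewrite divfK // mulrDr mulr1 -{1}xE; ring.
have txm_neq0 : t (gain01 (A.[xm] / B.[xm])) != 0 by rewrite txm.
have [L [L_itv LE]] :=
  locus_of_lift pole_not_zero t_cont t_pencil kinf_gt0 t_infinity km_gt0 txm_neq0.
have L_real z k : gain01 k = z -> f y <= z <= f xm -> rl_curve L k = (g z)%:C.
  by move=> kz z_itv; rewrite LE kz t_arc // arcE clamp_id.
have xm_uv : xm \in `[u, v]%R by rewrite in_itv /xm /=; case: (right); rewrite lexx ltW.
exists L; split.
  split=> //; rewrite (L_real (f xm)) ?lexx ?(ltW fy_lt) //.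
  by rewrite gK.
have gain_cvg := @cvg_at_left_filter _ _ _ _ _ (gain01_cvg (gain_ge0 xm)).
near=> k.
have k_lt : k < A.[xm] / B.[xm] by [].
have k_gt0 : 0 < k by near: k; exact: nbhs_left_gt.
(* For [k] just below the gain at [xm], [gain01 k] is still in the range of the arc, where the locus
   is the real point [g (gain01 k)] of [[u, v]]. *)
have k_itv : f y < gain01 k < f xm.
  apply/andP; split; last by rewrite -gkm ltr_gain01 // ltW.
  near: k; apply: (cvgr_gt _ gain_cvg).
  by rewrite gkm.
have [fyk kfxm] := andP k_itv.
have gk_itv : f y <= gain01 k <= f xm by rewrite !ltW.
have [gk_uv fgk] := gP _ gk_itv.
exists (g (gain01 k)); split; first exact: L_real.
have gk_neq : g (gain01 k) != xm.
  by apply: contraTneq kfxm => gk; rewrite -fgk gk ltxx.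
move: gk_uv gk_neq; rewrite in_itv /xm /= => /andP[ugk gkv].
by case: (right) => gk_neq; rewrite lt_neqAle ?gk_neq // eq_sym gk_neq.
Unshelve. all: end_near. Qed.

(** On each side of [xm] the gain is injective nearby, hence strictly below its maximum;
    [real_branch] then yields a locus reaching [xm] from that side as the gain grows. *)
Lemma max_real_breakaway_at_max xm :
  (forall x, f x <= f xm) -> 0 < f xm -> max_real_breakaway p xm.
Proof.
move=> f_le fxm_gt0; pose km := A.[xm] / B.[xm].
have f_lt x (I : interval R) : {in I &, injective f} -> x \in I -> xm \in I ->
    x != xm -> f x < f xm.
  move=> f_inj xI xmI x_neq; rewrite lt_neqAle f_le andbT.
  by apply: contraNneq x_neq => /f_inj ->.
have [v xm_v v_inj] := fraction_injective_right PPden_add_PPnum_neq0 coprime_AD size_A xm.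
have [u u_xm u_inj] := fraction_injective_left PPden_add_PPnum_neq0 coprime_AD size_A xm.
have [|L2 [L2_pass L2_side]] := @real_branch true xm v xm_v v_inj.
  by apply: f_lt v_inj _ _ _; rewrite ?in_itv /= ?lexx ?gt_eqF ?ltW.
have [|L1 [L1_pass L1_side]] := @real_branch false u xm u_xm u_inj.
  by apply: f_lt u_inj _ _ _; rewrite ?in_itv /= ?lexx ?lt_eqF ?ltW.
(* Just below the gain [km] the two loci lie on opposite sides of [xm], so they do not coincide near
   [km]. *)
have L12 : intersect_at L1 L2 xm%:C.
  exists km; split=> // eqL.
  have eqL' : \forall k \near km^'-, rl_curve L1 k = rl_curve L2 k.
    exact: cvg_within eqL.
  have [] : exists k : R, False; last by [].
  apply: (@filter_ex _ km^'- _); near=> k.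
  have eqk : rl_curve L1 k = rl_curve L2 k by near: k.
  have [x [Lx xxm]] : on_side false xm (rl_curve L1 k) by near: k; exact: L1_side.
  have [x' [Lx' x'xm]] : on_side true xm (rl_curve L2 k) by near: k; exact: L2_side.
  move: eqk; rewrite Lx Lx' => /complexI xx'.
  by move: x'xm; rewrite -xx' ltNge (ltW xxm).
have xm_not_zero : ~ is_zero p xm%:C.
  rewrite /is_zero ceval_real => /complexI/eqP; exact/negP.
have xm_not_pole : ~ is_pole p xm%:C.
  rewrite /is_pole ceval_real => /complexI A0; move: fxm_gt0.
  by rewrite /f /gain_fraction /fraction [A.[xm]]A0 mul0r ltxx.
split.
  split; first by split=> //; exists L1, L2.
  exists L1, L2; split=> //; left; split; first by exists km.
  by exists km.
near=> x; rewrite !gain_real lee_fin -ler_gain01 ?gain_ge0 // !gain01_PP; exact: f_le.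
Unshelve. all: end_near. Qed.
End RealBranch.

(** * Signs and numbers of real zeros *)

Section RealZerosTheory.
Variable R : realType.
Implicit Types (p q r : {poly R}) (a : pred R) (x y : R).

Lemma mem_rootsR q x : q != 0 -> (x \in rootsR q) = root q x.
Proof. by move=> q_neq0; have := roots_on_rootsR q_neq0 x; rewrite in_itv. Qed.

(** Points that are not roots have multiplicity 0; this allows a polynomial and its quotient to be
    counted over the same list. *)
Lemma nb_real_zeros_in_sub q a (s : seq R) : q != 0 -> uniq s ->
  (forall x, root q x -> x \in s) ->
  nb_real_zeros_in q a = (\sum_(x <- s | a x) mup x q)%N.
Proof.
move=> q_neq0 uniq_s roots_s.
have roots_perm : perm_eq (rootsR q) [seq x <- s | root q x].
  apply: uniq_perm; rewrite ?filter_uniq ?uniq_roots // => x.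
  rewrite mem_rootsR // mem_filter; case: (boolP (root q x)) => // /roots_s.
  by move=> ->.
rewrite /nb_real_zeros_in (perm_big _ roots_perm) /= big_filter_cond.
rewrite big_mkcond [RHS]big_mkcond /=; apply: eq_bigr => x _.
by case: (boolP (root q x)) => //= /mupNroot ->; case: ifP.
Qed.

Lemma nb_real_zeros_in_eq0 q a :
  (forall x, a x -> ~~ root q x) -> nb_real_zeros_in q a = 0%N.
Proof.
by move=> noroot; apply: big1 => x ax; apply: mupNroot; apply: noroot.
Qed.

Lemma sharp_r_eq0 q : sharp_r q = 0%E <-> forall x, ~~ root q x.
Proof.
rewrite /sharp_r; case: eqVneq => [->|q_neq0].
  by split=> // /(_ 0); rewrite root0.
split=> [[] /eqP|noroot]; last by rewrite nb_real_zeros_in_eq0.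
rewrite pnatr_eq0 sum_nat_seq_eq0 => /allP no_zeros x; apply/negP => qx.
have /no_zeros /= : x \in rootsR q by rewrite mem_rootsR.
by apply/negP; rewrite -lt0n -XsubC_dvd // dvdp_XsubCl.
Qed.

Lemma sharp_r_ge0 q : (0 <= sharp_r q)%E.
Proof. by rewrite /sharp_r; case: ifP => // _; rewrite lee_fin ler0n. Qed.

Lemma sgr_noroot_right q x : (forall y, x <= y -> ~~ root q y) ->
  Num.sg q.[x] = Num.sg (lead_coef q).
Proof.
move=> noroot; apply: (@sgp_pinftyP _ x); last by rewrite in_itv /= lexx.
by move=> y; rewrite in_itv andbT; apply: noroot.
Qed.

(** Induction on the size: a factor [X - y] with [x < y] is negative at [x], leaves the leading
    coefficient unchanged and adds one to the count. *)
Lemma sgr_right_zeros q x : q.[x] != 0 ->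
  Num.sg q.[x] = (-1) ^+ nb_real_zeros_in q (fun y => x < y) * Num.sg (lead_coef q).
Proof.
have [m] := ubnP (size q); elim: m q => // m IHm q; rewrite ltnS => size_q qx_neq0.
have q_neq0 : q != 0 by apply: contraNneq qx_neq0 => ->; rewrite horner0.
have [[y xy /factor_theorem [r qE]]|no_right] :=
    pselect (exists2 y, x < y & root q y); last first.
  have noroot y : x < y -> ~~ root q y.
    by move=> xy; apply/negP => qy; apply: no_right; exists y.
  rewrite nb_real_zeros_in_eq0 // mul1r; apply: sgr_noroot_right => y.
  by rewrite le_eqVlt => /predU1P[<-|/noroot].
have r_neq0 : r != 0 by apply: contraNneq q_neq0 => r0; rewrite qE r0 mul0r.
have rx_neq0 : r.[x] != 0.
  by apply: contraNneq qx_neq0 => rx; rewrite qE hornerM rx mul0r.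
have uniq_q : uniq (rootsR q) by exact: uniq_roots.
have mupE z : mup z q = ((y == z) + mup z r)%N.
  rewrite qE mupM ?polyXsubC_eq0 // addnC; congr addn.
  by have := mup_XsubCX 1 z y; rewrite expr1 => ->; case: eqP.
have -> : nb_real_zeros_in q (fun y => x < y) = (nb_real_zeros_in r (fun y => x < y)).+1.
  rewrite (nb_real_zeros_in_sub (q := r) _ _ uniq_q) // => [|z rz]; last first.
    by rewrite mem_rootsR // qE rootM rz.
  rewrite /nb_real_zeros_in; under eq_bigr do rewrite mupE.
  rewrite big_split /= -add1n; congr addn.
  rewrite -big_filter (bigD1_seq y) ?filter_uniq //=; last first.
    by rewrite mem_filter xy mem_rootsR // qE rootM root_XsubC eqxx orbT.
  by rewrite eqxx big1 // => z /negPf; rewrite eq_sym => ->.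
rewrite qE hornerM sgrM hornerXsubC (ltr0_sg (x := x - y)) ?subr_lt0 //.
rewrite IHm //; last first.
  by move: size_q; rewrite qE size_Mmonic ?monicXsubC // size_XsubC addn2.
by rewrite lead_coef_Mmonic ?monicXsubC // exprS; ring.
Qed.

(** An even size means an odd degree or the zero polynomial; in odd degree the signs at the two
    infinities are opposite. *)
Lemma odd_degree_root q : ~~ odd (size q) -> exists x, root q x.
Proof.
move=> even_size; have [->|q_neq0] := eqVneq q 0; first by exists 0; rewrite root0.
have [//|noroot] := pselect (exists x, root q x); exfalso.
have {}noroot x : ~~ root q x by apply/negP => qx; apply: noroot; exists x.
have := @sgp_pinftyP _ 0 q (fun x _ => noroot x) 0.
have := @sgp_minftyP _ 0 q (fun x _ => noroot x) 0.
rewrite !in_itv /= lexx => /(_ isT) -> /(_ isT)/eqP; rewrite /sgp_minfty /sgp_pinfty.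
rewrite -signr_odd; have -> : odd (size q).-1 = true.
  move: even_size; rewrite -size_poly_gt0 in q_neq0.
  by case: (size q) q_neq0 => // s _; rewrite negbK.
rewrite expr1 mulN1r sgrN eq_sym -addr_eq0 -mulr2n mulrn_eq0 /= sgr_eq0 lead_coef_eq0.
by rewrite (negPf q_neq0).
Qed.

Lemma largest_root q : q != 0 -> (exists x, root q x) ->
  exists2 x, root q x & forall y, x < y -> ~~ root q y.
Proof.
move=> q_neq0 [x0 qx0].
suff [x xq x_max] : exists2 x, x \in rootsR q & forall y, y \in rootsR q -> y <= x.
  exists x; first by rewrite -mem_rootsR.
  by move=> y; rewrite ltNge; apply: contra; rewrite -mem_rootsR // => /x_max.
have : rootsR q != [::] by apply: contraTneq qx0 => q0; rewrite -mem_rootsR // q0.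
elim: (rootsR q) => // x [|y s] IHs _.
  by exists x => [|z]; rewrite inE // => /eqP ->.
have [//|z zs z_max] := IHs; have [xz|zx] := leP x z.
  by exists z => [|w]; rewrite inE ?zs ?orbT // => /predU1P[->|/z_max].
exists x => [|w]; rewrite inE ?eqxx // => /predU1P[->//|/z_max /le_trans]; apply.
exact: ltW.
Qed.

(** Writing [p' = r (X - x)] gives [p''(x) = r(x)], and [r] has no root from [x] on, so it has there
    the sign of its leading coefficient. *)
Lemma sgr_deriv2_largest_root p x : root p^`() x ->
  (forall y, x < y -> ~~ root p^`() y) -> p^`(2).[x] != 0 ->
  Num.sg p^`(2).[x] = Num.sg (lead_coef p^`()).
Proof.
move=> /factor_theorem [r rE]; rewrite derivnS derivn1 rE => noroot.
rewrite derivM derivXsubC hornerD hornerM hornerXsubC subrr mulr0 add0r mulr1 => rx.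
rewrite lead_coef_Mmonic ?monicXsubC //; apply: sgr_noroot_right => y.
rewrite le_eqVlt => /predU1P[<-|/noroot]; first exact: rx.
by rewrite rootM negb_or => /andP[].
Qed.
End RealZerosTheory.

(** * The two implications *)

Section Main.
Variables (R : realType) (p : {poly R}) (n : nat).
Hypotheses (size_p : size p = n.+1) (even_n : ~~ odd n).
Implicit Types x y : R.

Let ppp := p^`(2) * p.

Let lead_coef_deriv (q : {poly R}) :
  lead_coef q^`() = (size q).-1%:R * lead_coef q.
Proof.
rewrite !lead_coefE size_deriv coef_deriv mulr_natl.
by case sq: (size q) => [|[|m]] //=; rewrite nth_default ?sq // mul0rn mulr0n.
Qed.

Let size_p' : size p^`() = n.
Proof. by rewrite size_deriv size_p. Qed.

Let size_p'' : size p^`(2) = n.-1.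
Proof. by rewrite derivnS derivn1 size_deriv size_p'. Qed.

Let deriv2E : p^`(2) = p^`()^`().
Proof. by rewrite derivnS derivn1. Qed.

Let sg_lead' : (0 < n)%N -> Num.sg (lead_coef p^`()) = Num.sg (lead_coef p).
Proof.
by move=> n_gt0; rewrite lead_coef_deriv size_p sgrM gtr0_sg ?ltr0n // mul1r.
Qed.

Let sg_lead'' : (1 < n)%N -> Num.sg (lead_coef p^`(2)) = Num.sg (lead_coef p).
Proof.
move=> n_gt1; rewrite deriv2E lead_coef_deriv size_p' sgrM gtr0_sg ?mul1r.
  exact/sg_lead'/ltnW.
by rewrite ltr0n -ltnS prednK // ltnW.
Qed.

Let n_gt1 : (0 < n)%N -> (1 < n)%N.
Proof. by case: n even_n => [|[]]. Qed.

Let p_neq0 : p != 0.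
Proof. by rewrite -size_poly_gt0 size_p. Qed.

Let p'_neq0 : (0 < n)%N -> p^`() != 0.
Proof. by rewrite -size_poly_gt0 size_p'. Qed.

Let critical : exists x, root p^`() x.
Proof. by apply: odd_degree_root; rewrite size_p'. Qed.

(** For [n > 0] this is the ratio of the leading coefficients of [p'^2] and [p'' p], the limit of
    the gain at infinity. *)
Let kinf : R := n%:R / (n%:R - 1).

Let n1_gt0 : (0 < n)%N -> 0 < n%:R - 1 :> R.
Proof. by move=> n_gt0; rewrite subr_gt0 ltr1n n_gt1. Qed.

Let kinf_gt0 : (0 < n)%N -> 0 < kinf.
Proof. by move=> n_gt0; rewrite divr_gt0 ?n1_gt0 // ltr0n. Qed.

Let K0E : K0 p = kinf.
Proof. by rewrite /K0 size_p. Qed.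

Let size_ppp : (0 < n)%N -> size ppp = (2 * n).-1.
Proof.
move=> n_gt0; have n2 := n_gt1 n_gt0.
have p''_neq0 : p^`(2) != 0 by rewrite -size_poly_gt0 size_p''; lia.
by rewrite size_mul // size_p'' size_p; lia.
Qed.

Let size_p'2 : (0 < n)%N -> size (p^`() ^+ 2) = size ppp.
Proof.
move=> n_gt0; rewrite size_ppp // expr2 size_mul ?p'_neq0 // size_p'; lia.
Qed.

Let lead_p'2 : (0 < n)%N -> lead_coef (p^`() ^+ 2) = kinf * lead_coef ppp.
Proof.
move=> n_gt0; have := n1_gt0 n_gt0 => n1.
rewrite lead_coef_exp lead_coefM deriv2E !lead_coef_deriv size_p' size_p /=.
rewrite -subn1 natrB // /kinf; field; by rewrite gt_eqF.
Qed.

(** For a constant [p] every point is a zero of [p'], against uniqueness. *)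
Let gamma_n_gt0 : Gamma p -> (0 < n)%N.
Proof.
case=> _ [x0 [_ uniq_x0]] _; rewrite lt0n; apply/eqP => n0.
have p'0 : p^`() = 0 by apply/eqP; rewrite -size_poly_eq0 size_p' n0.
have := uniq_x0 (x0 + 1); rewrite /= p'0 root0 => /(_ isT)/eqP.
by rewrite -subr_eq0 opprD addrA subrr sub0r oppr_eq0 oner_eq0.
Qed.

Let gamma_p0 : Gamma p ->
  [/\ root p^`() (p0 p), forall y, root p^`() y -> y = p0 p & p^`(2).[p0 p] != 0].
Proof.
move=> gp; have n_gt0 := gamma_n_gt0 gp; case: gp => _ [x0 [rx0 uniq_x0]].
have -> : p0 p = x0 by apply: xget_unique => // y ry; rewrite (uniq_x0 y).
move=> mup1; split=> // [y ry|]; first by rewrite (uniq_x0 y).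
have /factor_theorem [r rE] := rx0.
have r_neq0 : r != 0.
  by apply: contraNneq (p'_neq0 n_gt0) => r0; rewrite rE r0 mul0r.
rewrite deriv2E rE derivM derivXsubC hornerD hornerM hornerXsubC subrr mulr0 add0r mulr1.
rewrite -rootE -dvdp_XsubCl XsubC_dvd // lt0n negbK.
move: mup1; rewrite rE mupM ?polyXsubC_eq0 //.
by have := mup_XsubCX 1 x0 x0; rewrite eqxx expr1 => ->; rewrite addn1 => -[->].
Qed.

Let sg_deriv2_p0 : Gamma p -> Num.sg p^`(2).[p0 p] = Num.sg (lead_coef p).
Proof.
move=> gp; have [r0 uniq0 r2] := gamma_p0 gp.
rewrite -sg_lead' ?gamma_n_gt0 //; apply: sgr_deriv2_largest_root => // y.
by apply: contraTN => /uniq0 ->; rewrite ltxx.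
Qed.

Let even_right_zeros : Gamma p -> ~ odd_right_zeros p.
Proof.
move=> gp odd_zeros; have [_ _ r2] := gamma_p0 gp.
have := sgr_right_zeros r2; rewrite -signr_odd odd_zeros expr1 mulN1r.
rewrite sg_deriv2_p0 // sg_lead'' ?n_gt1 ?gamma_n_gt0 // => /eqP.
by rewrite -addr_eq0 -mulr2n mulrn_eq0 /= sgr_eq0 lead_coef_eq0 (negPf p_neq0).
Qed.

Let noroot_pos (q : {poly R}) x0 : (forall x, ~~ root q x) -> 0 < q.[x0] ->
  forall x, 0 < q.[x].
Proof.
move=> noroot q0 x; rewrite -(pmulr_rgt0 _ q0).
apply: (@noroot_noivt _ q (Num.min x0 x) (Num.max x0 x) (fun y _ => noroot y));
  by rewrite in_itv /= ge_min le_max lexx ?orbT.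
Qed.

Let sg_noroot : (forall x, ~~ root p x) -> forall x, Num.sg p.[x] = Num.sg (lead_coef p).
Proof. by move=> noroot x; apply: sgr_noroot_right. Qed.

Let pos_of_sg x : Num.sg p^`(2).[x] = Num.sg (lead_coef p) ->
  (forall x, ~~ root p x) -> 0 < ppp.[x].
Proof.
move=> sg2 noroot; rewrite -sgr_gt0 /ppp hornerM sgrM sg2 sg_noroot //.
by rewrite -expr2 exprn_even_gt0 //= sgr_eq0 lead_coef_eq0.
Qed.

Let gamma1_pos : Gamma1 p -> forall x, 0 < ppp.[x].
Proof.
move=> [gp noroot2]; have [noroot _ _] := gp.
apply: (noroot_pos (x0 := p0 p)).
  by move=> x; rewrite rootM negb_or noroot2 noroot.
by apply: pos_of_sg => //; apply: sg_deriv2_p0.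
Qed.

(** Two zeros of [p'] would enclose a zero of [p''] by Rolle's theorem; the one that exists by
    parity of the degree is simple since [p''] does not vanish there. *)
Let pos_gamma1 : (0 < n)%N -> (forall x, 0 < ppp.[x]) -> Gamma1 p.
Proof.
move=> n_gt0 pos.
have noroot x : ~~ root p x.
  by apply: contraTN (pos x) => /rootP px; rewrite hornerM px mulr0 ltxx.
have noroot2 x : ~~ root p^`(2) x.
  by apply: contraTN (pos x) => /rootP px; rewrite hornerM px mul0r ltxx.
have uniq_crit x y : x < y -> root p^`() x -> root p^`() y -> False.
  move=> xy /rootP px /rootP py; have [|c _] := poly_rolle xy (p := p^`()).
    by rewrite px py.
  by move=> /eqP; rewrite -rootE -deriv2E; apply/negP.
have [x0 rx0] := critical.
have uniq0 y : root p^`() y -> y = x0.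
  by move=> ry; case: (ltgtP y x0) => // yx0; case: (uniq_crit _ _ yx0).
split=> //; split=> //.
  by exists x0; split=> // y /uniq0.
have -> : p0 p = x0 by apply: xget_unique.
have /factor_theorem [r rE] := rx0.
have := noroot2 x0; rewrite rootE deriv2E rE derivM derivXsubC hornerD hornerM.
rewrite hornerXsubC subrr mulr0 add0r mulr1 => rx; rewrite mupMr //.
by have := mup_XsubCX 1 x0 x0; rewrite eqxx expr1.
Qed.

Let W := (n%:R - 1) *: p^`() ^+ 2 - n%:R *: (p * p^`(2)).

Let WE x : W.[x] = (n%:R - 1) * p^`().[x] ^+ 2 - n%:R * ppp.[x].
Proof. by rewrite /W /ppp [p * _]mulrC !(hornerE, horner_exp). Qed.

Let n_gt0_of_W : (forall x, ~~ root W x) -> (0 < n)%N.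
Proof.
move=> noroot; rewrite lt0n; apply/eqP => n0; have := noroot 0.
have p'0 : p^`() = 0 by apply/eqP; rewrite -size_poly_eq0 size_p' n0.
by rewrite rootE WE p'0 /ppp deriv2E p'0 derivC mul0r !horner0 expr0n !mulr0 subrr eqxx.
Qed.

Let W_neg : (forall x, ~~ root W x) -> (forall x, ~~ root p x) ->
  forall x, W.[x] < 0.
Proof.
move=> norootW noroot; have n_gt0 := n_gt0_of_W norootW.
have [x0 rx0 x0_max] := largest_root (p'_neq0 n_gt0) critical.
have nW : forall x, ~~ root (- W) x by move=> x; rewrite rootN.
suff W0 : 0 < (- W).[x0] by move=> x; rewrite -oppr_gt0 -hornerN; apply: noroot_pos W0 x.
have W0E : W.[x0] = - (n%:R * ppp.[x0]).
  by rewrite WE (rootP rx0) expr0n mulr0 sub0r.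
rewrite hornerN W0E opprK pmulr_rgt0 ?ltr0n //.
apply: pos_of_sg => //; rewrite -sg_lead' //; apply: sgr_deriv2_largest_root => //.
apply: contra (norootW x0) => /eqP p2; rewrite rootE W0E /ppp hornerM p2.
by rewrite mul0r mulr0 oppr0.
Qed.

Let f := gain_fraction p.

(** Since [gain01 kinf = n / (2n - 1)], clearing positive denominators leaves exactly [W(x) < 0]. *)
Let ltr_f_kinf x : (0 < n)%N -> (forall x, 0 < ppp.[x]) ->
  (f x < gain01 kinf) = (W.[x] < 0).
Proof.
move=> n_gt0 pos; rewrite /f (gain_fractionE pos) WE.
have D_gt0 : 0 < p^`().[x] ^+ 2 + ppp.[x] by rewrite ltr_wpDl ?sqr_ge0.
have n1 := n1_gt0 n_gt0; have n0 : 0 < n%:R :> R by rewrite ltr0n.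
have -> : gain01 kinf = n%:R / (n%:R + (n%:R - 1)).
  by rewrite /gain01 /kinf; field; rewrite !gt_eqF // addr_gt0.
have N_gt0 : 0 < n%:R + (n%:R - 1) :> R by exact: addr_gt0.
rewrite ltr_pdivrMr // mulrAC ltr_pdivlMr // -subr_lt0 -/ppp.
by congr (_ < 0); ring.
Qed.

(** A value above the limit at infinity confines the search for a maximum to a segment, where the
    extreme value theorem applies. *)
Let f_max_above x1 : (0 < n)%N -> (forall x, 0 < ppp.[x]) ->
  gain01 kinf < f x1 -> exists xm, forall x, f x <= f xm.
Proof.
move=> n_gt0 pos fx1; pose th := f x1.
(* The numerator of [f - th]: its sign compares [f] with the value at [x1]. *)
pose h := p^`() ^+ 2 - th *: (p^`() ^+ 2 + ppp).
have D_gt0 x : 0 < p^`().[x] ^+ 2 + ppp.[x] by rewrite ltr_wpDl ?sqr_ge0.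
have hE x : (f x < th) = (h.[x] < 0).
  rewrite /f (gain_fractionE pos) ltr_pdivrMr // -subr_lt0.
  by rewrite /h !(hornerE, horner_exp).
have lc_gt0 : 0 < lead_coef ppp.
  have noroot x : 0 <= x -> ~~ root ppp x.
    by move=> _; apply: contraTN (pos x) => /rootP ->; rewrite ltxx.
  by rewrite -sgr_gt0 -(sgr_noroot_right noroot) sgr_gt0.
pose m := (size ppp).-1.
have size_m : size ppp = m.+1 by rewrite /m size_ppp //; lia.
(* The top coefficient has the sign of [kinf - th (1 + kinf)], negative because [th] exceeds
   [gain01 kinf]. *)
have hm : h`_m < 0.
  rewrite coefB coefZ coefD.
  have -> : (p^`() ^+ 2)`_m = kinf * ppp`_m.
    by rewrite -[m]/(m.+1.-1) -size_m -lead_coefE -lead_p'2 // lead_coefE size_p'2.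
  have -> : kinf * ppp`_m - th * (kinf * ppp`_m + ppp`_m)
      = (kinf - th * (1 + kinf)) * ppp`_m by ring.
  rewrite pmulr_llt0; last by rewrite -[m]/(m.+1.-1) -size_m -lead_coefE.
  have k0 := kinf_gt0 n_gt0.
  by rewrite subr_lt0 -ltr_pdivrMr ?addr_gt0.
have size_h : size h = m.+1.
  apply/eqP; rewrite eqn_leq; apply/andP; split.
    rewrite (leq_trans (size_polyD _ _)) // size_polyN geq_max.
    rewrite size_p'2 // size_m leqnn /=.
    rewrite (leq_trans (size_scale_leq _ _)) // (leq_trans (size_polyD _ _)) //.
    by rewrite size_p'2 // size_m maxnn.
  by rewrite ltnNge; apply: contraTN hm => /leq_sizeP/(_ m (leqnn m)) ->; rewrite ltxx.
have h_neq0 : h != 0 by rewrite -size_poly_gt0 size_h.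
have lead_h : lead_coef h < 0 by rewrite lead_coefE size_h.
(* The degree [2n - 2] is even, so [h] is negative beyond its Cauchy bound on both sides. *)
have even_m : ~~ odd m by rewrite /m size_ppp //; lia.
pose M := cauchy_bound h; have M_ge0 : 0 <= M := cauchy_bound_ge0 h.
have h_neg x : x \notin `[- M, M]%R -> h.[x] < 0.
  rewrite in_itv /= negb_and -!ltNge -sgr_lt0 => /orP[xM|Mx].
    rewrite (sgp_minftyP (le_cauchy_bound h_neq0)) ?in_itv /= ?ltW //.
    by rewrite /sgp_minfty size_h -signr_odd (negPf even_m) mul1r sgr_lt0.
  rewrite (sgp_pinftyP (ge_cauchy_bound h_neq0)) ?in_itv /= ?andbT ?ltW //.
  by rewrite sgr_lt0.
have f_cont : continuous f.
  by apply: fraction_continuous; exact: PPden_add_PPnum_neq0.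
have [|xm xmM xm_max] := EVT_max _ (continuous_subspaceT f_cont (A := `[- M, M])).
  by rewrite -subr_ge0 opprK addr_ge0.
have x1_le : f x1 <= f xm.
  by apply: xm_max; apply/negPn/negP => /h_neg; rewrite -hE ltxx.
exists xm => x; have [/xm_max//|/h_neg] := boolP (x \in `[- M, M]%R).
by rewrite -hE => /ltW /le_trans; apply.
Qed.

Let W_noroot : Gamma1 p ->
  (forall x, max_real_breakaway p x -> (gain p x%:C < (K0 p)%:E)%E) ->
  forall x, ~~ root W x.
Proof.
move=> gp1 max_lt x1; apply/negP => /rootP W0.
have n_gt0 := gamma_n_gt0 gp1.1; have pos := gamma1_pos gp1.
have k0 := kinf_gt0 n_gt0.
have fx1 : gain01 kinf <= f x1 by rewrite leNgt ltr_f_kinf // W0 ltxx.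
have [xm xm_max xm_ge] : exists2 xm, forall x, f x <= f xm & gain01 kinf <= f xm.
  (* If [f] never exceeds [gain01 kinf], the zero [x1] of [W] is itself a global maximum. *)
  have [[x2 fx2]|no_above] := pselect (exists x, gain01 kinf < f x).
    have [xm xm_max] := f_max_above n_gt0 pos fx2.
    by exists xm => //; rewrite (le_trans (ltW fx2)).
  exists x1 => // x; rewrite (le_trans _ fx1) // leNgt.
  by apply/negP => fx; apply: no_above; exists x.
have fxm_gt0 : 0 < f xm.
  by rewrite (lt_le_trans _ xm_ge) //; have /andP[] := gain01_itv k0.
have := max_lt xm (max_real_breakaway_at_max pos (size_p'2 n_gt0) k0 (lead_p'2 n_gt0)
  critical xm_max fxm_gt0).
rewrite gain_real // lte_fin K0E -ltr_gain01 ?gain_ge0 ?(ltW k0) // gain01_PP //.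
by rewrite ltNge xm_ge.
Qed.

Let gain_lt_K0 : (forall x, ~~ root W x) -> (forall x, ~~ root p x) ->
  Gamma1 p /\ forall x, (gain p x%:C < (K0 p)%:E)%E.
Proof.
move=> norootW noroot; have n_gt0 := n_gt0_of_W norootW.
have W_lt0 := W_neg norootW noroot; have n1 := n1_gt0 n_gt0.
have n0 : 0 < n%:R :> R by rewrite ltr0n.
have pos x : 0 < ppp.[x].
  have := W_lt0 x; rewrite WE subr_lt0 -(pmulr_rgt0 _ n0); apply: le_lt_trans.
  by rewrite mulr_ge0 ?sqr_ge0 // ltW.
split=> [|x]; first exact: pos_gamma1.
have k0 := ltW (kinf_gt0 n_gt0).
rewrite gain_real // lte_fin K0E -ltr_gain01 ?gain_ge0 // gain01_PP //.
by rewrite ltr_f_kinf.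
Qed.

Lemma zeros_iff_classes :
  (sharp_r W + sharp_r p = 0 :> \bar R)%E <->
  [\/ Gamma11 p, Gamma121 p, Gamma2121 p | Gamma2321 p].
Proof.
split=> [/eqP|].
  rewrite padde_eq0 ?sharp_r_ge0 //.
  move=> /andP[/eqP/sharp_r_eq0 norootW /eqP/sharp_r_eq0 noroot].
  have [gp1 gain_lt] := gain_lt_K0 norootW noroot.
  have [[x std]|no_std] := pselect (exists x, standard_real_breakaway p x).
    by apply: Or42; split=> //; split=> //; exists x.
  by apply: Or41; split=> // x std; apply: no_std; exists x.
(* Both [Gamma11] and [Gamma121] supply the bound on the maxima, the former vacuously. *)
have zeros : Gamma1 p ->
    (forall x, max_real_breakaway p x -> (gain p x%:C < (K0 p)%:E)%E) ->
    (sharp_r W + sharp_r p = 0 :> \bar R)%E.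
  move=> gp1 max_lt; have [noroot _ _] := gp1.1.
  have -> : sharp_r W = 0%E by apply/sharp_r_eq0; exact: W_noroot.
  by rewrite add0e; apply/sharp_r_eq0.
case=> [[gp1 no_std]|[[gp1 _] max_lt]|[[[[gp _] _ _] odd_z] _ _]
       |[[[[gp _] _ _] odd_z] _ _ _ _]].
- by apply: zeros => // x [std _]; case: (no_std x).
- exact: zeros.
- by case: (even_right_zeros gp).
- by case: (even_right_zeros gp).
Qed.
End Main.

Theorem theorem1p12 (R : realType) (p : {poly R}) (n : nat)
    (size_p : size p = n.+1) (even_n : ~~ odd n) :
  (sharp_r ((n%:R - 1) *: p^`() ^+ 2 - n%:R *: (p * p^`(2))) + sharp_r p
     = 0 :> \bar R)%E
  <-> [\/ Gamma11 p, Gamma121 p, Gamma2121 p | Gamma2321 p].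
Proof. exact: zeros_iff_classes. Qed.
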